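(* (Within Bishop's constructive mathematics.) Let $N$ be a positive integer and let $\mathbf{S}=(S^{1},S^{0})$ be a measurable complemented set in $\mathbb{R}^{N}$ such that $S^{1}$ is convex and the complement ${\sim}S^{1}=\{x\in\mathbb{R}^{N}: x\neq s\text{ for all }s\in S^{1}\}$ is inhabited. Then ${\sim}S^{1}$ is located in $\mathbb{R}^{N}$.
   Context: The framework is Bishop's constructive mathematics (intuitionistic logic; no law of excluded middle or Markov's principle). $\rho$ is the Euclidean metric on $\mathbb{R}^{N}$ and $\mu$ is Lebesgue measure. For reals, $x\neq y$ means $|x-y|>0$; for points of $\mathbb{R}^{N}$, $x\neq y$ means $\rho(x,y)>0$. A set is inhabited if an element of it can be constructed. A complemented set in $\mathbb{R}^{N}$ is a pair $\mathbf{A}=(A^{1},A^{0})$ of subsets of $\mathbb{R}^{N}$ such that $x\neq y$ whenever $x\in A^{1}$, $y\in A^{0}$. Its characteristic function $\chi_{\mathbf{A}}$ has domain $A^{1}\cup A^{0}$ and $\chi_{\mathbf{A}}(x)=k$ if $x\in A^{k}$. Integration is in the sense of Bishop and Bridges: a real-valued partial function $f$ on $\mathbb{R}^{N}$ is integrable if there is a sequence $(f_n)$ of continuous functions with compact support such that $\sum_n\int|f_n|$ converges and, whenever $\sum_n|f_n(x)|$ converges, $x$ is in the domain of $f$ and $f(x)=\sum_n f_n(x)$; then $\int f=\sum_n\int f_n$ (integrals of the $f_n$ being Riemann integrals). A full set is one that contains the domain of some integrable function. $\mathbf{A}$ is integrable if $\chi_{\mathbf{A}}$ is integrable, and then $\mu(\mathbf{A})=\int\chi_{\mathbf{A}}$.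 $\mathbf{A}$ is measurable if $\chi_{\mathbf{A}}$ is measurable; a partial function $f$ defined on a full set is measurable if for each integrable complemented set $\mathbf{B}$ and each $\varepsilon>0$ there exist an integrable complemented set $\mathbf{C}$ with $\mathbf{C}<\mathbf{B}$ and $\mu(\mathbf{B})-\mu(\mathbf{C})<\varepsilon$, and an integrable function $g$, such that $|f-g|<\varepsilon$ on $C^{1}$. Here $\mathbf{C}<\mathbf{B}$ means $\chi_{\mathbf{C}}\leqslant\chi_{\mathbf{B}}$ (wherever both are defined). A subset $S$ of $\mathbb{R}^{N}$ is located in $\mathbb{R}^{N}$ if it is inhabited and for each $x\in\mathbb{R}^{N}$ the distance $\rho(x,S)=\inf\{\rho(x,s):s\in S\}$ exists, i.e. there is a real $m$ with $m\leqslant\rho(x,s)$ for all $s\in S$ and, for each $\varepsilon>0$, some $s\in S$ with $\rho(x,s)<m+\varepsilon$. *)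

(* Defs.v *)
(* Bishop-style analysis over an arbitrary model of Stdlib's interface for the
   constructive reals.  Propositions carrying data live in [Type]: "exists" and
   "or" are [sigT] and [sum], and subsets are [Type]-valued predicates, so that
   an axiom-free term is a constructive proof. *)
From Stdlib Require Fin Vector.
From Stdlib Require Import PeanoNat QArith Qabs Qround Lqa ZArith Lia.
From Stdlib Require Import ConstructiveReals ConstructiveAbs ConstructiveLimits
  ConstructiveSum.

Local Open Scope ConstructiveReals.

(** * Square roots *)

Lemma Qsqr_le_reg (a b : Q) : (0 <= b -> a * a <= b * b -> a <= b)%Q.
Proof. intros. destruct (Qlt_le_dec b a); [nra | assumption]. Qed.

Lemma Qsqrt_approx (q : Q) (p : positive) : (0 <= q)%Q ->
  {r : Q | (0 <= r /\ r * r <= q /\ q <= (r + (1 # p)) * (r + (1 # p)))%Q}.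
Proof.
  intro Hq.
  set (m := Qfloor (q * inject_Z (Z.pos p * Z.pos p))).
  assert (Hm : (0 <= m)%Z).
  { change 0%Z with (Qfloor 0). apply Qfloor_resp_le.
    apply Qmult_le_0_compat; [exact Hq|]. unfold Qle; simpl; lia. }
  exists (Z.sqrt m # p).
  pose proof (Z.sqrt_spec m Hm) as [H1 H2].
  pose proof (Z.sqrt_nonneg m) as H0.
  pose proof (Qfloor_le (q * inject_Z (Z.pos p * Z.pos p))) as H3.
  pose proof (Qlt_floor (q * inject_Z (Z.pos p * Z.pos p))) as H4.
  fold m in H3, H4.
  destruct q as [a d]. unfold Qle, Qlt, Qmult, Qplus, inject_Z in *. simpl in *.
  repeat split; nia.
Qed.

Section Sqrt.
Context {R : ConstructiveReals}.
Add Ring CRring : (CRisRing R).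
Notation Qr := (CR_of_Q R).

Definition CRsqrt_seq_sig (x : CRcarrier R) (Hx : 0 <= x) (n : nat) :
  let p := Pos.of_succ_nat n in
  {r : Q | (0 <= r)%Q /\ Qr (r * r) <= x + Qr ((1 # p) * (1 # p))
           /\ x <= Qr ((r + (1 # p)) * (r + (1 # p)))}.
Proof.
  intro p.
  destruct (CR_Q_dense R x (x + Qr ((1 # p) * (1 # p)))) as [q [H1 H2]].
  { rewrite <- (CRplus_0_r x) at 1. apply CRplus_lt_compat_l, CR_of_Q_lt.
    reflexivity. }
  assert (Hq : (0 <= q)%Q).
  { apply Qlt_le_weak, (lt_CR_of_Q R). exact (CRle_lt_trans _ _ _ Hx H1). }
  destruct (Qsqrt_approx q p Hq) as [r [H3 [H4 H5]]].
  exists r. split; [exact H3|]. split.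
  - apply CRle_trans with (Qr q); [apply CR_of_Q_le, H4 | apply CRlt_asym, H2].
  - apply CRle_trans with (Qr q); [apply CRlt_asym, H1 | apply CR_of_Q_le, H5].
Defined.

Definition CRsqrt_seq x Hx n : Q := proj1_sig (CRsqrt_seq_sig x Hx n).

Lemma CR_of_Q_le_reg (a b : Q) : Qr a <= Qr b -> (a <= b)%Q.
Proof.
  intro H. destruct (Qlt_le_dec b a) as [l|l]; [|exact l].
  destruct (H (CR_of_Q_lt R _ _ l)).
Qed.

Lemma CRsqrt_seq_le x Hx i j :
  (CRsqrt_seq x Hx i <= CRsqrt_seq x Hx j
     + (1 # Pos.of_succ_nat j) + (1 # Pos.of_succ_nat i))%Q.
Proof.
  unfold CRsqrt_seq.
  destruct (CRsqrt_seq_sig x Hx i) as [r [H1 [H2 H3]]].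
  destruct (CRsqrt_seq_sig x Hx j) as [s [H4 [H5 H6]]]. simpl.
  set (d := (1 # Pos.of_succ_nat i)%Q) in *.
  set (e := (1 # Pos.of_succ_nat j)%Q) in *.
  assert (0 <= d)%Q by (unfold d, Qle; simpl; lia).
  assert (0 <= e)%Q by (unfold e, Qle; simpl; lia).
  assert (r * r <= (s + e) * (s + e) + d * d)%Q.
  { apply CR_of_Q_le_reg. rewrite CR_of_Q_plus.
    apply (CRle_trans _ _ _ H2). apply CRplus_le_compat_r, H6. }
  apply Qsqr_le_reg; nra.
Qed.

Lemma CRsqrt_seq_cauchy x Hx : CR_cauchy R (fun n => Qr (CRsqrt_seq x Hx n)).
Proof.
  intro p. exists (Pos.to_nat (2 * p)). intros i j Hi Hj.
  assert (A : forall k, (Pos.to_nat (2 * p) <= k)%nat ->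
              (1 # Pos.of_succ_nat k <= 1 # (2 * p))%Q).
  { intros k Hk. unfold Qle; simpl. lia. }
  pose proof (A i Hi). pose proof (A j Hj).
  pose proof (CRsqrt_seq_le x Hx i j). pose proof (CRsqrt_seq_le x Hx j i).
  assert (E : ((1 # p) == (1 # 2 * p) + (1 # 2 * p))%Q)
    by (unfold Qeq; simpl; lia).
  unfold CRminus. rewrite <- CR_of_Q_opp, <- CR_of_Q_plus, CR_of_Q_abs.
  apply CR_of_Q_le. apply Qabs_Qle_condition. split; lra.
Qed.

Lemma CR_le_eps (a b c : CRcarrier R) :
  (forall n, a <= b + c * Qr (1 # Pos.of_succ_nat n)) -> a <= b.
Proof.
  intros H Hlt.
  assert (P : 0 < a - b) by (apply CRlt_minus, Hlt).
  destruct (CR_Q_dense R _ _ P) as [q [Hq1 Hq2]].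
  apply (lt_CR_of_Q R 0 q) in Hq1.
  destruct (CR_archimedean R c) as [k Hk].
  destruct q as [u v].
  assert (Hu : (0 < u)%Z) by (unfold Qlt in Hq1; simpl in Hq1; lia).
  set (n := Pos.to_nat (k * v)).
  apply (H n).
  assert (L : Qr ((Z.pos k # 1) * (1 # Pos.of_succ_nat n)) <= Qr (u # v)).
  { apply CR_of_Q_le. unfold Qle, n; simpl. nia. }
  apply CRle_lt_trans with (b + Qr (u # v)).
  - apply CRplus_le_compat_l.
    refine (CRle_trans _ _ _ _ L). rewrite CR_of_Q_mult.
    apply CRmult_le_compat_r; [|apply CRlt_asym, Hk].
    apply CR_of_Q_le. unfold Qle; simpl; lia.
  - apply (CRplus_lt_compat_l R b) in Hq2.
    refine (CRlt_le_trans _ _ _ Hq2 _).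
    setoid_replace (b + (a - b)) with a by (unfold CRminus; ring).
    apply CRle_refl.
Qed.

Lemma CRsqr_le_compat (a b : CRcarrier R) : 0 <= a -> a <= b -> a * a <= b * b.
Proof.
  intros H1 H2. apply CRle_trans with (a * b).
  - apply CRmult_le_compat_l; assumption.
  - apply CRmult_le_compat_r; [|assumption]. exact (CRle_trans _ _ _ H1 H2).
Qed.

Definition CRsqrt_sig (x : CRcarrier R) (Hx : 0 <= x) :
  {y : CRcarrier R & 0 <= y /\ y * y == x}.
Proof.
  destruct (CR_complete R _ (CRsqrt_seq_cauchy x Hx)) as [y Hy].
  exists y.
  assert (Y0 : 0 <= y).
  { refine (CR_cv_bound_down _ _ _ O _ Hy). intros n _.
    apply CR_of_Q_le. exact (proj1 (proj2_sig (CRsqrt_seq_sig x Hx n))). }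
  split; [exact Y0|].
  assert (B : forall i, let e := Qr (1 # Pos.of_succ_nat i) in
     y <= Qr (CRsqrt_seq x Hx i) + e + e /\ Qr (CRsqrt_seq x Hx i) <= y + e + e).
  { intros i e. split.
    - refine (CR_cv_bound_up _ _ _ i _ Hy). intros j Hj. unfold e.
      rewrite <- !CR_of_Q_plus. apply CR_of_Q_le.
      pose proof (CRsqrt_seq_le x Hx j i).
      assert (1 # Pos.of_succ_nat j <= 1 # Pos.of_succ_nat i)%Q
        by (unfold Qle; simpl; lia). lra.
    - rewrite CRplus_assoc.
      apply CRplus_le_reg_r with (- (e + e)).
      setoid_replace (y + (e + e) + - (e + e)) with y by ring.
      refine (CR_cv_bound_down _ _ _ i _ Hy). intros j Hj. unfold e.
      rewrite <- CR_of_Q_plus, <- CR_of_Q_opp, <- CR_of_Q_plus.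
      apply CR_of_Q_le.
      pose proof (CRsqrt_seq_le x Hx i j).
      assert (1 # Pos.of_succ_nat j <= 1 # Pos.of_succ_nat i)%Q
        by (unfold Qle; simpl; lia). lra. }
  assert (E1 : forall i, 0 <= Qr (1 # Pos.of_succ_nat i)
                    /\ Qr (1 # Pos.of_succ_nat i) <= 1).
  { intro i; split; apply CR_of_Q_le; unfold Qle; simpl; lia. }
  pose (three := (1 + 1 + 1 : CRcarrier R)).
  pose (four := (1 + 1 + 1 + 1 : CRcarrier R)).
  assert (T0 : 0 <= three).
  { unfold three. rewrite <- !CR_of_Q_plus. apply CR_of_Q_le. discriminate. }
  assert (F0 : 0 <= four).
  { unfold four. rewrite <- !CR_of_Q_plus. apply CR_of_Q_le. discriminate. }
  split.
  - (* x <= y * y *)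
    apply CR_le_eps with ((y + y + three) * three). intro i.
    destruct (B i) as [_ B2]. destruct (E1 i) as [e0 e1].
    unfold CRsqrt_seq in B2.
    destruct (CRsqrt_seq_sig x Hx i) as [r [H1 [H2 H3]]]. simpl in B2.
    rewrite CR_of_Q_mult, CR_of_Q_plus in H3.
    set (e := Qr (1 # Pos.of_succ_nat i)) in *. set (z := Qr r) in *.
    assert (Z0 : 0 <= z) by (apply CR_of_Q_le, H1).
    apply (CRle_trans _ _ _ H3).
    assert (K : z + e <= y + e + e + e) by (apply CRplus_le_compat_r, B2).
    assert (K0 : 0 <= z + e).
    { rewrite <- (CRplus_0_l 0). apply CRplus_le_compat; assumption. }
    apply (CRle_trans _ _ _ (CRsqr_le_compat _ _ K0 K)).
    setoid_replace ((y + e + e + e) * (y + e + e + e))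
      with (y * y + (y + y + three * e) * three * e) by (unfold three; ring).
    apply CRplus_le_compat_l, CRmult_le_compat_r; [exact e0|].
    apply CRmult_le_compat_r; [exact T0|].
    apply CRplus_le_compat_l. rewrite <- (CRmult_1_r three) at 2.
    apply CRmult_le_compat_l; [exact T0 | exact e1].
  - (* y * y <= x *)
    apply CR_le_eps with ((y + three) * four + 1). intro i.
    destruct (B i) as [B1 B2]. destruct (E1 i) as [e0 e1].
    unfold CRsqrt_seq in B1, B2.
    destruct (CRsqrt_seq_sig x Hx i) as [r [H1 [H2 H3]]]. simpl in B1, B2.
    rewrite !CR_of_Q_mult in H2.
    set (e := Qr (1 # Pos.of_succ_nat i)) in *. set (z := Qr r) in *.
    apply (CRle_trans _ _ _ (CRsqr_le_compat _ _ Y0 B1)).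
    setoid_replace ((z + e + e) * (z + e + e))
      with (z * z + (z + e) * four * e) by (unfold four; ring).
    apply CRle_trans with (x + e * e + (y + e + e + e) * four * e).
    { apply CRplus_le_compat; [exact H2|].
      apply CRmult_le_compat_r; [exact e0|].
      apply CRmult_le_compat_r; [exact F0|]. apply CRplus_le_compat_r, B2. }
    rewrite CRplus_assoc. apply CRplus_le_compat_l.
    setoid_replace (e * e + (y + e + e + e) * four * e)
      with (((y + three * e) * four + e) * e) by (unfold three, four; ring).
    apply CRmult_le_compat_r; [exact e0|].
    apply CRplus_le_compat; [|exact e1].
    apply CRmult_le_compat_r; [exact F0|].
    apply CRplus_le_compat_l. rewrite <- (CRmult_1_r three) at 2.
    apply CRmult_le_compat_l; [exact T0 | exact e1].
Defined.

Lemma CRsqr_nonneg (a : CRcarrier R) : 0 <= a * a.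
Proof.
  intro H.
  assert (N1 : a <= 0).
  { intro P. exact (CRlt_asym _ _ H (CRmult_lt_0_compat R _ _ P P)). }
  assert (N2 : 0 <= a).
  { intro P. apply (CRopp_gt_lt_contravar) in P. rewrite CRopp_0 in P.
    apply (CRlt_asym _ _ H).
    setoid_replace (a * a) with ((- a) * (- a)) by ring.
    exact (CRmult_lt_0_compat R _ _ P P). }
  assert (E : a == 0) by (split; assumption).
  rewrite E, CRmult_0_r in H. exact (CRle_refl _ H).
Qed.

Lemma CRsqr_eq_reg (a b : CRcarrier R) :
  0 <= a -> 0 <= b -> a * a == b * b -> a == b.
Proof.
  assert (H : forall u v : CRcarrier R, 0 <= v -> u * u == v * v -> u <= v).
  { intros u v Hv E L.
    assert (Hu : 0 < u) by exact (CRle_lt_trans _ _ _ Hv L).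
    assert (v * v < u * u); [|apply (CRle_refl (v * v)); rewrite <- E at 2; assumption].
    apply CRle_lt_trans with (u * v).
    - apply CRmult_le_compat_r; [exact Hv | apply CRlt_asym, L].
    - apply CRmult_lt_compat_l; assumption. }
  intros Ha Hb E. split; apply H; try assumption. symmetry; exact E.
Qed.

Definition CRsqrt (x : CRcarrier R) (Hx : 0 <= x) : CRcarrier R :=
  projT1 (CRsqrt_sig x Hx).

Lemma CRsqrt_nonneg x Hx : 0 <= CRsqrt x Hx.
Proof. exact (proj1 (projT2 (CRsqrt_sig x Hx))). Qed.

Lemma CRsqrt_sqr x Hx : CRsqrt x Hx * CRsqrt x Hx == x.
Proof. exact (proj2 (projT2 (CRsqrt_sig x Hx))). Qed.

Lemma CRsqrt_ext x y Hx Hy : x == y -> CRsqrt x Hx == CRsqrt y Hy.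
Proof.
  intro E. apply CRsqr_eq_reg; try apply CRsqrt_nonneg.
  rewrite !CRsqrt_sqr. exact E.
Qed.

End Sqrt.

(** * Euclidean space *)

Fixpoint fin_fold {A : Type} (op : A -> A -> A) (e : A) {n : nat}
  : (Fin.t n -> A) -> A :=
  match n with
  | O => fun _ => e
  | S _ => fun f => op (f Fin.F1) (fin_fold op e (fun i => f (Fin.FS i)))
  end.

Definition fin_sum {R : ConstructiveReals} {n} (f : Fin.t n -> CRcarrier R)
  : CRcarrier R := fin_fold (CRplus R) 0 f.

Definition fin_prod {R : ConstructiveReals} {n} (f : Fin.t n -> CRcarrier R)
  : CRcarrier R := fin_fold (CRmult R) 1 f.

Lemma fin_sum_ext {R : ConstructiveReals} {n} (f g : Fin.t n -> CRcarrier R) :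
  (forall i, f i == g i) -> fin_sum f == fin_sum g.
Proof.
  unfold fin_sum. induction n as [|n IH]; intro H; simpl; [reflexivity|].
  apply CRplus_morph; [apply H | apply IH; intro; apply H].
Qed.

Lemma fin_sum_nonneg {R : ConstructiveReals} {n} (f : Fin.t n -> CRcarrier R) :
  (forall i, 0 <= f i) -> 0 <= fin_sum f.
Proof.
  unfold fin_sum. induction n as [|n IH]; intro H; simpl; [apply CRle_refl|].
  apply CRle_trans with (0 + 0 : CRcarrier R).
  - rewrite CRplus_0_l. apply CRle_refl.
  - apply CRplus_le_compat; [apply H | apply IH; intro; apply H].
Qed.

Lemma fin_sum_zero {R : ConstructiveReals} {n} :
  fin_sum (fun _ : Fin.t n => 0 : CRcarrier R) == 0.
Proof.
  unfold fin_sum. induction n as [|n IH]; simpl; [reflexivity|].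
  rewrite IH. apply CRplus_0_l.
Qed.

Definition point (R : ConstructiveReals) (N : nat) : Set :=
  Fin.t N -> CRcarrier R.

Definition pt_eq {R N} (x y : point R N) : Prop := forall i, x i == y i.

Definition origin {R N} : point R N := fun _ => 0.

Definition sqdist {R N} (x y : point R N) : CRcarrier R :=
  fin_sum (fun i => (x i - y i) * (x i - y i)).

Lemma sqdist_nonneg {R N} (x y : point R N) : 0 <= sqdist x y.
Proof. apply fin_sum_nonneg. intro i. apply CRsqr_nonneg. Qed.

Definition rho {R N} (x y : point R N) : CRcarrier R :=
  CRsqrt (sqdist x y) (sqdist_nonneg x y).

Definition pt_apart {R N} (x y : point R N) : Type := 0 < rho x y.

Lemma rho_ext {R N} (x x' y y' : point R N) :
  pt_eq x x' -> pt_eq y y' -> rho x y == rho x' y'.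
Proof.
  intros Hx Hy. apply CRsqrt_ext, fin_sum_ext. intro i.
  unfold CRminus. rewrite (Hx i), (Hy i). reflexivity.
Qed.

Lemma pt_apart_neq {R N} (x y : point R N) : pt_apart x y -> pt_eq x y -> False.
Proof.
  unfold pt_apart. intros H E. apply (CRle_refl (0 : CRcarrier R)).
  assert (Z : rho x y * rho x y == 0).
  { unfold rho. rewrite CRsqrt_sqr. unfold sqdist.
    rewrite <- (@fin_sum_zero R N). apply fin_sum_ext. intro i.
    unfold CRminus. rewrite (E i), CRplus_opp_r. apply CRmult_0_l. }
  rewrite <- Z at 2. apply CRmult_lt_0_compat; exact H.
Qed.

(** * Subsets *)

Record subset (R : ConstructiveReals) (N : nat) : Type := {
  mem :> point R N -> Type;
  mem_ext : forall x y, pt_eq x y -> mem x -> mem y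
}.
Arguments mem {R N}.
Arguments mem_ext {R N}.

Definition inhabited_set {R N} (A : subset R N) : Type := {x : point R N & A x}.

Definition convex {R N} (A : subset R N) : Type :=
  forall x y : point R N, A x -> A y ->
  forall t : CRcarrier R, 0 <= t -> t <= 1 ->
  A (fun i => t * x i + (1 - t) * y i).

Definition complement {R N} (A : subset R N) : subset R N.
Proof.
  refine {| mem := fun x => forall s : point R N, A s -> pt_apart x s |}.
  abstract (unfold pt_apart; intros x y E H s Hs;
    rewrite <- (rho_ext x y s s E (fun i => CReq_refl (s i))); exact (H s Hs)).
Defined.

Definition is_distance {R N} (x : point R N) (A : subset R N)
  (m : CRcarrier R) : Type :=
  (forall s : point R N, A s -> m <= rho x s) *
  (forall eps : CRcarrier R, 0 < eps ->
     {s : point R N & A s & rho x s < m + eps}).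

Definition located {R N} (A : subset R N) : Type :=
  inhabited_set A * (forall x : point R N, {m : CRcarrier R & is_distance x A m}).

Record complemented_set (R : ConstructiveReals) (N : nat) : Type := {
  in1 : subset R N;
  in0 : subset R N;
  in1_in0_apart : forall x y : point R N, in1 x -> in0 y -> pt_apart x y
}.
Arguments in1 {R N}.
Arguments in0 {R N}.
Arguments in1_in0_apart {R N}.

(** * Partial functions *)

(* The value may not depend on the witness of membership in the domain. *)
Record partial_function (R : ConstructiveReals) (N : nat) : Type := {
  dom : subset R N;
  value : forall x : point R N, dom x -> CRcarrier R;
  value_ext : forall x y (p : dom x) (q : dom y),
    pt_eq x y -> value x p == value y q
}.
Arguments dom {R N}.
Arguments value {R N}.
Arguments value_ext {R N}.

Definition union {R N} (A B : subset R N) : subset R N.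
Proof.
  refine {| mem := fun x : point R N => (A x + B x)%type |}.
  abstract (intros x y E [p|p];
    [left; exact (mem_ext A x y E p) | right; exact (mem_ext B x y E p)]).
Defined.

Definition chi {R N} (A : complemented_set R N) : partial_function R N.
Proof.
  refine {|
    dom := union (in1 A) (in0 A);
    value := fun x p => match p with inl _ => 1 | inr _ => 0 end
  |}.
  abstract (intros x y [p|p] [q|q] E; try reflexivity; exfalso;
    [ exact (pt_apart_neq _ _ (in1_in0_apart A x y p q) E)
    | exact (pt_apart_neq _ _ (in1_in0_apart A y x q p)
               (fun i => CReq_sym _ _ (E i))) ]).
Defined.

(** * Test functions and their Riemann integrals *)

(* In the locally compact space R^N, continuity means uniform continuity on
   compact sets, equivalently on closed balls. *)
Definition continuous {R N} (f : point R N -> CRcarrier R) : Type :=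
  forall r eps : CRcarrier R, 0 < eps ->
  {delta : CRcarrier R & 0 < delta &
    forall x y : point R N, rho x origin <= r -> rho y origin <= r ->
      rho x y <= delta -> CRabs R (f x - f y) <= eps}.

Definition vanishes_beyond {R N} (f : point R N -> CRcarrier R)
  (r : CRcarrier R) : Type :=
  forall x : point R N, r < rho x origin -> f x == 0.

Definition test_function {R N} (f : point R N -> CRcarrier R) : Type :=
  continuous f *
  {r : CRcarrier R & 0 < r & vanishes_beyond f r}.

(* A grid on the box [a, b] subdivides the k-th side by the nodes
   node k 0 <= ... <= node k (last_cell[k] + 1), so that cells are indexed by
   the multi-indices j with
   0 <= j[k] <= last_cell[k]; each cell carries a tag. *)
Record tagged_partition {R N} (a b : point R N) : Type := {
  last_cell : Vector.t nat N;
  node : Fin.t N -> nat -> CRcarrier R;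
  tag : Vector.t nat N -> point R N;
  node_first : forall k, node k O == a k;
  node_last : forall k, node k (S (Vector.nth last_cell k)) == b k;
  node_incr : forall k i, (i <= Vector.nth last_cell k)%nat ->
    node k i <= node k (S i);
  tag_in_cell : forall j : Vector.t nat N,
    (forall k, (Vector.nth j k <= Vector.nth last_cell k)%nat) ->
    forall k, node k (Vector.nth j k) <= tag j k <= node k (S (Vector.nth j k))
}.
Arguments last_cell {R N a b}.
Arguments node {R N a b}.
Arguments tag {R N a b}.

Definition mesh_le {R N} {a b : point R N} (P : tagged_partition a b)
  (delta : CRcarrier R) : Prop :=
  forall k i, (i <= Vector.nth (last_cell P) k)%nat ->
    node P k (S i) - node P k i <= delta.

(* [CRsum u n] is u 0 + ... + u n, bound included. *)
Fixpoint grid_sum {R : ConstructiveReals} {n : nat} (m : Vector.t nat n)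
  : (Vector.t nat n -> CRcarrier R) -> CRcarrier R :=
  match m in Vector.t _ n
    return (Vector.t nat n -> CRcarrier R) -> CRcarrier R with
  | Vector.nil _ => fun F => F (Vector.nil nat)
  | Vector.cons _ h _ m' => fun F =>
      CRsum (fun i => grid_sum m' (fun j => F (Vector.cons nat i _ j))) h
  end.

Definition riemann_sum {R N} {a b : point R N} (f : point R N -> CRcarrier R)
  (P : tagged_partition a b) : CRcarrier R :=
  grid_sum (last_cell P) (fun j =>
    f (tag P j) *
    fin_prod (fun k => node P k (S (Vector.nth j k)) - node P k (Vector.nth j k))).

Definition is_box_integral {R N} (f : point R N -> CRcarrier R)
  (a b : point R N) (I : CRcarrier R) : Type :=
  forall eps : CRcarrier R, 0 < eps ->
  {delta : CRcarrier R & 0 < delta &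
    forall P : tagged_partition a b, mesh_le P delta ->
      CRabs R (riemann_sum f P - I) <= eps}.

(* [f] vanishes off the ball of radius [r], hence off the cube [-r, r]^N. *)
Definition is_riemann_integral {R N} (f : point R N -> CRcarrier R)
  (I : CRcarrier R) : Type :=
  {r : CRcarrier R & 0 < r &
    (vanishes_beyond f r * is_box_integral f (fun _ => - r) (fun _ => r) I)%type}.

(** * The Lebesgue integral *)

(* The values of the Riemann integrals of the f_n and |f_n| are recorded as
   data; they exist and are unique because the f_n are test functions. *)
Record has_integral {R N} (f : partial_function R N) (I : CRcarrier R)
  : Type := {
  rep : nat -> point R N -> CRcarrier R;
  rep_test : forall n, test_function (rep n);
  rep_int : nat -> CRcarrier R;
  rep_int_spec : forall n, is_riemann_integral (rep n) (rep_int n);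
  rep_abs_int : nat -> CRcarrier R;
  rep_abs_int_spec : forall n,
    is_riemann_integral (fun x => CRabs R (rep n x)) (rep_abs_int n);
  rep_abs_cv : {s : CRcarrier R & series_cv rep_abs_int s};
  rep_value : forall x : point R N,
    {s : CRcarrier R & series_cv (fun n => CRabs R (rep n x)) s} ->
    {p : dom f x & series_cv (fun n => rep n x) (value f x p)};
  rep_int_cv : series_cv rep_int I
}.

Definition integrable {R N} (f : partial_function R N) : Type :=
  {I : CRcarrier R & has_integral f I}.

Definition full {R N} (A : subset R N) : Type :=
  {f : partial_function R N & integrable f & forall x : point R N, dom f x -> A x}.

(* [has_measure A m] : A is integrable and its measure is m. *)
Definition has_measure {R N} (A : complemented_set R N) (m : CRcarrier R)
  : Type := has_integral (chi A) m.

Definition compl_lt {R N} (C B : complemented_set R N) : Type :=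
  forall (x : point R N) (p : dom (chi C) x) (q : dom (chi B) x),
    value (chi C) x p <= value (chi B) x q.

(* The inequality |f - g| < eps is required where both sides are defined, as in
   [compl_lt]. *)
Definition measurable {R N} (f : partial_function R N) : Type :=
  full (dom f) *
  (forall (B : complemented_set R N) (mB : CRcarrier R), has_measure B mB ->
   forall eps : CRcarrier R, 0 < eps ->
   {C : complemented_set R N & {mC : CRcarrier R & {g : partial_function R N &
     (has_measure C mC * compl_lt C B * (mB - mC < eps) * integrable g *
      (forall (x : point R N) (p : dom f x) (q : dom g x), in1 C x ->
         CRabs R (value f x p - value g x q) < eps))%type}}}).

Definition measurable_set {R N} (A : complemented_set R N) : Type :=
  measurable (chi A).

(* Main.v *)
(** The union of A1 and A0 is full, and a full set meets every box in a point
    that can be constructed: if the f_n represent an integrable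
    function and the blocks H_k of the series of the |f_n| are so long that the
    integral of H_k is at most 4^-k vol / 16, then repeated halving of the box,
    always passing to a half on which the remaining weighted means
    2^k mean(H_k) still add up to less than 1, converges to a point x with
    H_k(x) <= 2 * 2^-k for all k, so x is in the domain.

    Given x and a < b, put a fine grid of cells around x.  In each cell close
    to the ball of radius a there is a point of A1 or a point of A0.  If some
    cell yields a point of A0, this point is in the complement of A1 at
    distance less than b from x.  Otherwise any y with rho x y < a has points
    of A1 in all the open orthants at y, so that y is in A1 by convexity, and
    hence a is a lower bound of the distances from x to the complement.
    Bisection with this decision yields the distance. *)

From Stdlib Require Fin Vector.
From Stdlib Require Import PeanoNat QArith Qring ZArith Lia.
From Stdlib Require Import ConstructiveReals ConstructiveAbs ConstructiveLimits
  ConstructiveSum ConstructiveMinMax ConstructivePower.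
Require Import Defs.

Local Open Scope ConstructiveReals.

(** * Rational coefficients for [ring] *)

Section Tools.
Context {R : ConstructiveReals}.
Notation C := (CRcarrier R).

Definition CR_ring_theory :
  ring_theory (CR_of_Q R 0) (CR_of_Q R 1) (CRplus R) (CRmult R) (CRminus R)
    (CRopp R) (CReq R) := CRisRing R.

(** Lets [ring] compute with rational coefficients, so that identities with halves, quarters or
    sixths need no preparation. *)
Lemma CR_of_Q_ring_morph :
  ring_morph (CR_of_Q R 0) (CR_of_Q R 1) (CRplus R) (CRmult R) (CRminus R)
    (CRopp R) (CReq R) 0%Q 1%Q Qplus Qmult Qminus Qopp Qeq_bool (CR_of_Q R).
Proof.
  split; try reflexivity.
  - exact (CR_of_Q_plus R).
  - intros x y. unfold Qminus, CRminus. rewrite CR_of_Q_plus, CR_of_Q_opp. reflexivity.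
  - exact (CR_of_Q_mult R).
  - intro x. apply CR_of_Q_opp.
  - intros x y H. apply CR_of_Q_morph, Qeq_bool_eq, H.
Qed.
End Tools.

Ltac CRcst t :=
  match t with
  | CR_of_Q _ ?q => match isQcst q with true => q | _ => constr:(InitialRing.NotConstant) end
  | _ => constr:(InitialRing.NotConstant)
  end.

Section Located.
Context {R : ConstructiveReals}.
Notation C := (CRcarrier R).

Add Ring CRring : (@CR_ring_theory R)
  (morphism (@CR_of_Q_ring_morph R), constants [CRcst]).

Lemma CRle_by (a b c d : C) : c <= d -> b - a == d - c -> a <= b.
Proof.
  intros H E. apply CRle_minus in H. rewrite <- E in H.
  apply (CRplus_le_compat_r a) in H.
  setoid_replace (0 + a) with a in H by ring.
  setoid_replace (b - a + a) with b in H by ring. exact H.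
Qed.

Lemma CRlt_by (a b c d : C) : c < d -> b - a == d - c -> a < b.
Proof.
  intros H E. apply CRlt_minus in H. rewrite <- E in H.
  apply (CRplus_lt_compat_r a) in H.
  setoid_replace (0 + a) with a in H by ring.
  setoid_replace (b - a + a) with b in H by ring. exact H.
Qed.

Lemma CReq_by (a b c d : C) : c == d -> b - a == d - c -> a == b.
Proof.
  intros H E. rewrite H in E.
  setoid_replace a with (b - (b - a)) by ring. rewrite E. ring.
Qed.

Lemma CRscale_le (q : Q) (a b : C) : (0 <= q)%Q -> a <= b -> CR_of_Q R q * a <= CR_of_Q R q * b.
Proof. intros Hq H. apply CRmult_le_compat_l; [apply CR_of_Q_le, Hq | exact H]. Qed.

Lemma CRscale_lt (q : Q) (a b : C) : (0 < q)%Q -> a < b -> CR_of_Q R q * a < CR_of_Q R q * b.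
Proof. intros Hq H. apply CRmult_lt_compat_l; [apply CR_of_Q_lt, Hq | exact H]. Qed.

Lemma CRle_eq (a b : C) : a == b -> a <= b.
Proof. intro H. rewrite H. apply CRle_refl. Qed.

(* [cle], [clt] and [ceq] derive a linear relation from a given combination of
   known ones, whose equivalence to the goal is left to [ring]. *)
Local Notation "H &+ K" := (CRplus_le_compat _ _ _ _ H K) (at level 50, left associativity).
Local Notation "H <+ K" := (CRplus_lt_le_compat _ _ _ _ H K) (at level 50, left associativity).
Local Notation "q &* H" := (CRscale_le q _ _ ltac:(discriminate) H) (at level 40).
Local Notation "q <* H" := (CRscale_lt q _ _ eq_refl H) (at level 40).
Notation half := (CR_of_Q R (1 # 2)).

Ltac cle H := apply (CRle_by _ _ _ _ H); ring.
Ltac clt H := apply (CRlt_by _ _ _ _ H); ring.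
Ltac ceq H := apply (CReq_by _ _ _ _ H); ring.

(** * Powers of one half and embedded natural numbers *)

Notation pw := (CRpow half).

Lemma pw_pos n : 0 < pw n.
Proof. apply CRpow_gt_zero, CR_of_Q_lt. reflexivity. Qed.

Lemma pw_nonneg n : 0 <= pw n.
Proof. apply CRlt_asym, pw_pos. Qed.

Lemma pw_S n : pw (S n) == half * pw n.
Proof. reflexivity. Qed.

Lemma INR_S n : @INR R (S n) == INR n + 1.
Proof.
  unfold INR. rewrite <- CR_of_Q_plus. apply CR_of_Q_morph.
  unfold Qeq, Qplus, Qnum, Qden. lia.
Qed.

Lemma INR_plus m n : @INR R (m + n) == INR m + INR n.
Proof.
  induction m as [|m IH]; [unfold INR; simpl; ring|].
  change (S m + n)%nat with (S (m + n)). rewrite !INR_S, IH. ring.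
Qed.

Lemma INR_nonneg n : 0 <= @INR R n.
Proof. apply CR_of_Q_le. unfold Qle; simpl; lia. Qed.

Lemma INR_pow2 e : @INR R (2 ^ e) * pw e == 1.
Proof.
  induction e as [|e IH]; [unfold INR; simpl; ring|].
  rewrite Nat.pow_succ_r', pw_S. replace (2 * 2 ^ e)%nat with (2 ^ e + 2 ^ e)%nat by lia.
  rewrite INR_plus. ceq IH.
Qed.

(** * Finite sums *)

(** The bound is excluded, unlike in [CRsum], so that sums may be empty and blocks of indices
    concatenate without a shift. *)
Fixpoint sum_lt (f : nat -> C) (n : nat) : C :=
  match n with O => 0 | S k => sum_lt f k + f k end.

Lemma CRsum_sum_lt f n : CRsum f n == sum_lt f (S n).
Proof. induction n as [|n IH]; simpl in *; [|rewrite IH]; ring. Qed.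

Lemma sum_lt_le f g n : (forall i, (i < n)%nat -> f i <= g i) -> sum_lt f n <= sum_lt g n.
Proof.
  induction n as [|n IH]; intro H; simpl; [apply CRle_refl|].
  apply CRplus_le_compat; [apply IH; intros; apply H; lia | apply H; lia].
Qed.

Lemma sum_lt_ext f g n : (forall i, (i < n)%nat -> f i == g i) -> sum_lt f n == sum_lt g n.
Proof. intro H; split; apply sum_lt_le; intros i Hi; apply CRle_eq; [symmetry|]; auto. Qed.

Lemma sum_lt_nonneg f n : (forall i, (i < n)%nat -> 0 <= f i) -> 0 <= sum_lt f n.
Proof.
  intro H. induction n as [|n IH]; simpl; [apply CRle_refl|].
  assert (A : 0 <= sum_lt f n) by (apply IH; intros; apply H; lia).
  assert (B : 0 <= f n) by (apply H; lia). cle (A &+ B).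
Qed.

Lemma sum_lt_add f m n : sum_lt f (m + n) == sum_lt f m + sum_lt (fun i => f (m + i)%nat) n.
Proof.
  induction n as [|n IH]; [rewrite Nat.add_0_r; simpl; ring|].
  rewrite Nat.add_succ_r. simpl. rewrite IH. ring.
Qed.

Lemma sum_lt_scale a f n : sum_lt (fun i => a * f i) n == a * sum_lt f n.
Proof. induction n as [|n IH]; simpl; [|rewrite IH]; ring. Qed.

(** * Dyadic averages over boxes *)

(* The mean of f over the points a + i * side / 2^e with 0 <= i < 2^e. *)
Fixpoint avg1 (e : nat) (f : C -> C) (a side : C) : C :=
  match e with
  | O => f a
  | S e' => half * (avg1 e' f a (half * side)
                    + avg1 e' f (a + half * side) (half * side))
  end.

Lemma avg1_le e f g a s : (forall u, f u <= g u) -> avg1 e f a s <= avg1 e g a s.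
Proof.
  intro H; revert a s; induction e as [|e IH]; intros a s; simpl; [apply H|].
  cle ((1#2) &* (IH a (half * s) &+ IH (a + half * s) (half * s))).
Qed.

Lemma avg1_ext e f g a b s t : (forall u v, u == v -> f u == g v) ->
  a == b -> s == t -> avg1 e f a s == avg1 e g b t.
Proof.
  intro H; revert a b s t; induction e as [|e IH]; intros a b s t Ha Hs; simpl.
  - apply H, Ha.
  - rewrite (IH a b (half * s) (half * t)),
     (IH (a + half * s) (b + half * t) (half * s) (half * t)); try reflexivity;
    rewrite ?Ha, ?Hs; reflexivity.
Qed.

Lemma avg1_linear e k f g a s :
  avg1 e (fun u => k * f u + g u) a s == k * avg1 e f a s + avg1 e g a s.
Proof.
  revert a s; induction e as [|e IH]; intros a s; simpl; [|rewrite !IH]; ring.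
Qed.

Lemma avg1_const e k a s : avg1 e (fun _ => k) a s == k.
Proof.
  revert a s; induction e as [|e IH]; intros a s; simpl; [|rewrite !IH]; ring.
Qed.

Lemma avg1_sum e f a s : (forall u v, u == v -> f u == f v) ->
  avg1 e f a s == pw e * sum_lt (fun i => f (a + INR i * (pw e * s))) (2 ^ e).
Proof.
  intro H; revert a s; induction e as [|e IH]; intros a s.
  - simpl. rewrite CRmult_1_l, CRplus_0_l. apply H. unfold INR; simpl. ring.
  - rewrite Nat.pow_succ_r'. replace (2 * 2 ^ e)%nat with (2 ^ e + 2 ^ e)%nat by lia.
    rewrite sum_lt_add. cbn [avg1]. rewrite !IH, pw_S.
    rewrite (sum_lt_ext (fun i => f (a + INR i * (half * pw e * s)))
               (fun i => f (a + INR i * (pw e * (half * s))))) by (intros; apply H; ring).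
    rewrite (sum_lt_ext (fun i => f (a + INR (2 ^ e + i) * (half * pw e * s)))
               (fun i => f (a + half * s + INR i * (pw e * (half * s))))).
    + ring.
    + intros i _. apply H. rewrite INR_plus.
      (* In the right half, [2 ^ e] steps of length [half * pw e * s] lead exactly to the midpoint
         [a + half * s]. *)
      assert (K : s * half * (INR (2 ^ e) * pw e) == s * half * 1)
        by (rewrite INR_pow2; reflexivity).
      ceq K.
Qed.

(** * Points by coordinates and averages in several variables *)

Definition proper {n} (F : point R n -> C) : Prop := forall x y, pt_eq x y -> F x == F y.

Definition pcons {n} (u : C) (y : point R n) : point R (S n) :=
  fun i => Fin.caseS' i (fun _ => C) u y.

Lemma pcons_eq {n} u v (x y : point R n) : u == v -> pt_eq x y -> pt_eq (pcons u x) (pcons v y).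
Proof. intros H K i. apply (Fin.caseS' i); simpl; auto. Qed.

Definition ptail {A : Type} {n} (x : Fin.t (S n) -> A) : Fin.t n -> A := fun i => x (Fin.FS i).

Lemma pcons_head_tail {n} (x : point R (S n)) : pt_eq (pcons (x Fin.F1) (ptail x)) x.
Proof. intro i. apply (Fin.caseS' i); simpl; reflexivity. Qed.

Lemma proper_pcons {n} (F : point R (S n) -> C) u : proper F -> proper (fun y => F (pcons u y)).
Proof. intros H x y E. apply H, pcons_eq; [reflexivity | exact E]. Qed.

(** Each coordinate has its own depth and side, so that a box can be halved in one direction at a
    time. *)
Fixpoint avg {n} : (Fin.t n -> nat) -> (point R n -> C) -> point R n -> point R n -> C :=
  match n with
  | O => fun _ F c _ => F c
  | S n' => fun d F c side =>
      avg1 (d Fin.F1)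
        (fun u => avg (ptail d) (fun y => F (pcons u y)) (ptail c) (ptail side))
        (c Fin.F1) (side Fin.F1)
  end.

Lemma avg_le {n} d (F G : point R n -> C) c s :
  (forall x, F x <= G x) -> avg d F c s <= avg d G c s.
Proof.
  revert d F G c s; induction n as [|n IH]; intros d F G c s H; simpl; [apply H|].
  apply avg1_le. intro u. apply IH. intro y. apply H.
Qed.

Lemma avg_ext {n} d d' (F G : point R n -> C) c c' s s' :
  (forall x y, pt_eq x y -> F x == G y) ->
  (forall i, d i = d' i) -> pt_eq c c' -> pt_eq s s' -> avg d F c s == avg d' G c' s'.
Proof.
  revert d d' F G c c' s s'; induction n as [|n IH];
    intros d d' F G c c' s s' H Hd Hc Hs; simpl.
  - apply H, Hc.
  - rewrite (Hd Fin.F1). apply avg1_ext; [|apply Hc|apply Hs].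
    intros u v E. apply IH; try solve [intro i; unfold ptail; auto].
    intros x y E'. apply H, pcons_eq; assumption.
Qed.

Lemma avg_pcons_ext {n} d (F : point R (S n) -> C) c s u v : proper F -> u == v ->
  avg d (fun y => F (pcons u y)) c s == avg d (fun y => F (pcons v y)) c s.
Proof.
  intros HF E. apply avg_ext; try (intro; reflexivity).
  intros x y E'. apply HF, pcons_eq; assumption.
Qed.

Lemma avg_linear {n} d k (F G : point R n -> C) c s :
  avg d (fun x => k * F x + G x) c s == k * avg d F c s + avg d G c s.
Proof.
  revert d F G c s; induction n as [|n IH]; intros d F G c s; simpl; [reflexivity|].
  rewrite <- avg1_linear. split; apply avg1_le; intro u; apply CRle_eq; [symmetry|]; apply IH.
Qed.

Lemma avg_const {n} d k c s : avg d (fun _ : point R n => k) c s == k.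
Proof.
  revert d c s; induction n as [|n IH]; intros d c s; simpl; [reflexivity|].
  etransitivity; [|apply (avg1_const (d Fin.F1) k (c Fin.F1) (s Fin.F1))].
  split; apply avg1_le; intro u; apply CRle_eq; [symmetry|]; apply IH.
Qed.

Lemma avg_nonneg {n} d (F : point R n -> C) c s :
  (forall x, 0 <= F x) -> 0 <= avg d F c s.
Proof. intro H. rewrite <- (avg_const d 0 c s). apply avg_le, H. Qed.

Lemma avg_depth0 {n} (F : point R n -> C) c s : proper F -> avg (fun _ => O) F c s == F c.
Proof.
  revert F c s; induction n as [|n IH]; intros F c s H; simpl; [reflexivity|].
  unfold ptail at 1. rewrite IH by (apply proper_pcons, H).
  apply H, pcons_head_tail.
Qed.

(** For the first coordinate this is the recursion step of [avg1]. For a later one the inner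
    averages split by induction, and the outer [avg1] is linear. *)
Lemma avg_split {n} (k : Fin.t n) d d' (F : point R n -> C) c c' s s' : proper F ->
  d k = S (d' k) -> (forall j, j <> k -> d j = d' j) ->
  c' k == c k + s' k -> (forall j, j <> k -> c' j == c j) ->
  s' k == half * s k -> (forall j, j <> k -> s' j == s j) ->
  avg d F c s == half * (avg d' F c s' + avg d' F c' s').
Proof.
  revert d d' F c c' s s'; induction k as [n|n k IH];
    intros d d' F c c' s s' HF Hd Hd' Hc Hc' Hs Hs'; simpl.
  - rewrite Hd. simpl.
    apply CRmult_morph; [reflexivity|].
    apply CRplus_morph; apply avg1_ext; try (rewrite ?Hc, ?Hs; reflexivity);
      intros u v E.
    + apply avg_ext; [intros x y E'; apply HF, pcons_eq; assumption| | |];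
        intro i; unfold ptail; [apply Hd'|reflexivity|symmetry; apply Hs']; discriminate.
    + apply avg_ext; [intros x y E'; apply HF, pcons_eq; assumption| | |];
        intro i; unfold ptail; [apply Hd'|symmetry; apply Hc'|symmetry; apply Hs']; discriminate.
  - rewrite (Hd' Fin.F1) by discriminate.
    assert (P : forall (x y : point R n) u v, u == v ->
      avg (ptail d') (fun y => F (pcons u y)) x y
      == avg (ptail d') (fun y => F (pcons v y)) x y)
      by (intros; apply avg_pcons_ext; assumption).
    rewrite (avg1_ext _ _ (fun u => avg (ptail d') (fun y => F (pcons u y)) (ptail c') (ptail s'))
      (c' Fin.F1) (c Fin.F1) (s' Fin.F1) (s Fin.F1));
      [|intros; apply P; assumption|apply Hc'; discriminate|apply Hs'; discriminate].
    rewrite (avg1_ext _ _ (fun u => avg (ptail d') (fun y => F (pcons u y)) (ptail c) (ptail s'))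
      (c Fin.F1) (c Fin.F1) (s' Fin.F1) (s Fin.F1));
      [|intros; apply P; assumption|reflexivity|apply Hs'; discriminate].
    set (f := fun u => avg (ptail d') (fun y => F (pcons u y)) (ptail c) (ptail s')).
    set (g := fun u => avg (ptail d') (fun y => F (pcons u y)) (ptail c') (ptail s')).
    (* The final [+ 0] gives the sum of two functions the shape of [avg1_linear], which is used
       twice. *)
    transitivity (avg1 (d' Fin.F1) (fun u => half * f u + (half * g u + 0)) (c Fin.F1) (s Fin.F1)).
    2:{ rewrite !avg1_linear, avg1_const. ring. }
    apply avg1_ext; try reflexivity. intros u v E.
    rewrite (IH (ptail d) (ptail d') (fun y => F (pcons u y)) (ptail c) (ptail c')
               (ptail s) (ptail s')).
    + rewrite !(P _ _ u v E). unfold f, g. ring.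
    + apply proper_pcons, HF.
    + exact Hd.
    + intros j Hj. apply Hd'. intro Q. apply Hj, Fin.FS_inj, Q.
    + exact Hc.
    + intros j Hj. apply Hc'. intro Q. apply Hj, Fin.FS_inj, Q.
    + exact Hs.
    + intros j Hj. apply Hs'. intro Q. apply Hj, Fin.FS_inj, Q.
Qed.

(** * Averages bounded by sums over grids *)

Lemma grid_sum_nonneg {n} (m : Vector.t nat n) (Phi : Vector.t nat n -> C) :
  (forall j, 0 <= Phi j) -> 0 <= grid_sum m Phi.
Proof.
  induction m as [|h n m IH]; intro H; simpl; [apply H|].
  apply cond_pos_sum. intro i. apply IH. intro; apply H.
Qed.

(** The sample points of the average belong to the cells with all indices in [[J, J + 2 ^ m)]. A
    factor [pw m] per coordinate turns their sum into a mean, and the other cells contribute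
    nonnegative terms. As [grid_sum] includes its bound [T], there are [S T] cells per side. *)
Lemma avg_le_grid_sum {N} m T J (Phi : Vector.t nat N -> C) F c s :
  (J + 2 ^ m <= S T)%nat -> (forall j, 0 <= Phi j) -> proper F ->
  (forall j, (forall k, (J <= Vector.nth j k < J + 2 ^ m)%nat) ->
     F (fun k => c k + INR (Vector.nth j k - J) * (pw m * s)) <= Phi j) ->
  avg (fun _ => m) F c (fun _ => s) <= CRpow (pw m) N * grid_sum (Vector.const T N) Phi.
Proof.
  intro HT. revert Phi F c; induction N as [|N IH]; intros Phi F c HPhi HF H.
  - simpl. rewrite CRmult_1_l.
    refine (CRle_trans _ _ _ _ (H (Vector.nil nat) _)).
    + apply CRle_eq, HF. intro k; apply (Fin.case0 (fun k => c k == _) k).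
    + intro k; apply (Fin.case0 (fun k => (J <= Vector.nth (Vector.nil nat) k < _)%nat) k).
  - cbn [avg].
    rewrite avg1_sum by (intros; apply avg_pcons_ext; assumption).
    change (Vector.const T (S N)) with (Vector.cons nat T N (Vector.const T N)).
    cbn [grid_sum].
    set (A := fun i => grid_sum (Vector.const T N) (fun j => Phi (Vector.cons nat i N j))).
    assert (HA : forall i, 0 <= A i) by (intro; apply grid_sum_nonneg; intro; apply HPhi).
    apply CRle_trans with (pw m * (CRpow (pw m) N * sum_lt (fun i => A (J + i)%nat) (2 ^ m))).
    + apply CRmult_le_compat_l; [apply pw_nonneg|]. rewrite <- sum_lt_scale.
      apply sum_lt_le. intros i Hi. apply IH.
      * intro; apply HPhi.
      * apply proper_pcons, HF.
      * intros j Hj.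
        refine (CRle_trans _ _ _ _ (H (Vector.cons nat (J + i)%nat N j) _)).
        -- apply CRle_eq, HF. intro k. apply (Fin.caseS' k); simpl.
           ++ replace (J + i - J)%nat with i by lia. reflexivity.
           ++ intro; reflexivity.
        -- intro k. apply (Fin.caseS' k); simpl; [lia | exact Hj].
    + change (CRpow (pw m) (S N)) with (pw m * CRpow (pw m) N). rewrite CRmult_assoc.
      apply CRmult_le_compat_l; [apply pw_nonneg|].
      apply CRmult_le_compat_l; [apply CRpow_ge_zero, pw_nonneg|].
      rewrite CRsum_sum_lt.
      (* The indices before and after the block give nonnegative sums, which are dropped. *)
      replace (S T) with (J + (2 ^ m + (S T - J - 2 ^ m)))%nat by lia.
      rewrite !sum_lt_add.
      assert (P1 : 0 <= sum_lt A J) by (apply sum_lt_nonneg; auto).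
      assert (P2 : 0 <= sum_lt (fun i => A (J + (2 ^ m + i))%nat) (S T - J - 2 ^ m))
        by (apply sum_lt_nonneg; auto).
      cle (P1 &+ P2).
Qed.

(** * Coordinates and the Euclidean metric *)

Lemma CRsqr_le_reg (a b : C) : 0 <= b -> a * a <= b * b -> a <= b.
Proof.
  intros Hb H L. apply H.
  assert (Ha : 0 < a) by exact (CRle_lt_trans _ _ _ Hb L).
  apply CRle_lt_trans with (b * a).
  - apply CRmult_le_compat_l; [exact Hb | apply CRlt_asym, L].
  - apply CRmult_lt_compat_r; assumption.
Qed.

Lemma CRabs_sqr (a : C) : CRabs R a * CRabs R a == a * a.
Proof. rewrite <- CRabs_mult. apply CRabs_right, CRsqr_nonneg. Qed.

Lemma fin_sum_le {n} (f g : Fin.t n -> C) : (forall i, f i <= g i) -> fin_sum f <= fin_sum g.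
Proof.
  unfold fin_sum. induction n as [|n IH]; intro H; simpl; [apply CRle_refl|].
  apply CRplus_le_compat; [apply H | apply IH; intro; apply H].
Qed.

Lemma fin_sum_const {n} (a : C) : fin_sum (fun _ : Fin.t n => a) == INR n * a.
Proof.
  unfold fin_sum. induction n as [|n IH]; simpl; [unfold INR; simpl; ring|].
  rewrite IH, INR_S. ring.
Qed.

Lemma fin_sum_term {n} (f : Fin.t n -> C) i : (forall i, 0 <= f i) -> f i <= fin_sum f.
Proof.
  revert f; induction i as [n|n i IH]; intros f H; unfold fin_sum; simpl.
  - pose proof (fin_sum_nonneg (fun i => f (Fin.FS i)) (fun i => H (Fin.FS i))) as K.
    unfold fin_sum in K. cle K.
  - pose proof (IH (fun i => f (Fin.FS i)) (fun i => H (Fin.FS i))) as K.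
    unfold fin_sum in K. cle (H Fin.F1 &+ K).
Qed.

Lemma rho_sqr {N} (x y : point R N) : rho x y * rho x y == sqdist x y.
Proof. apply CRsqrt_sqr. Qed.

Lemma rho_nonneg {N} (x y : point R N) : 0 <= rho x y.
Proof. apply CRsqrt_nonneg. Qed.

Lemma coord_le_rho {N} (x y : point R N) k : CRabs R (x k - y k) <= rho x y.
Proof.
  apply CRsqr_le_reg; [apply rho_nonneg|]. rewrite CRabs_sqr, rho_sqr.
  apply (fin_sum_term (fun i => (x i - y i) * (x i - y i))). intro; apply CRsqr_nonneg.
Qed.

(** The factor [INR N] in place of its square root suffices, by N <= N^2. *)
Lemma rho_le_coord {N} (x y : point R N) b : 0 <= b ->
  (forall k, CRabs R (x k - y k) <= b) -> rho x y <= INR N * b.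
Proof.
  intros Hb H. pose proof (INR_nonneg N) as HN.
  apply CRsqr_le_reg; [apply CRmult_le_0_compat; assumption|].
  rewrite rho_sqr. apply CRle_trans with (INR N * (b * b)).
  - rewrite <- fin_sum_const. apply fin_sum_le. intro i. rewrite <- CRabs_sqr.
    apply CRsqr_le_compat; [apply CRabs_pos | apply H].
  - setoid_replace (INR N * b * (INR N * b)) with (INR N * INR N * (b * b)) by ring.
    apply CRmult_le_compat_r; [apply CRsqr_nonneg|].
    unfold INR. rewrite <- CR_of_Q_mult. apply CR_of_Q_le.
    unfold Qle, Qmult, Qnum, Qden. nia.
Qed.

Lemma point_bound {N} (c : point R N) : {B : C & 0 <= B & forall k, CRabs R (c k) <= B}.
Proof.
  exists (fin_sum (fun k => CRabs R (c k))).
  - apply fin_sum_nonneg. intro; apply CRabs_pos.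
  - intro k. apply (fin_sum_term (fun k => CRabs R (c k))). intro; apply CRabs_pos.
Qed.

Lemma pw_small (y x : C) : 0 < x ->
  {m0 : nat & forall m, (m0 <= m)%nat -> y * pw m <= x}.
Proof.
  intro Hx.
  destruct (Un_cv_nat_real _ _ (CR_cv_scale _ y _ (@GeoCvZero R)) x Hx) as [m0 H].
  exists m0. intros m Hm. specialize (H m Hm). apply CRlt_asym in H.
  pose proof (CRle_trans _ _ _ (CRle_abs _) H) as K. cle K.
Qed.

Lemma archimedean_mult (a w : C) : 0 < w -> {n : nat & a <= INR n * w}.
Proof.
  intro Hw. destruct (CRup_nat (a * CRinv R w (inr Hw))) as [n Hn].
  exists n. apply CRlt_asym in Hn.
  apply (CRmult_le_compat_r w) in Hn; [|apply CRlt_asym, Hw].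
  rewrite CRmult_assoc, CRinv_l, CRmult_1_r in Hn. exact Hn.
Qed.

(** Coordinatewise equal points are at distance 0, hence within every [delta], so their values
    differ by at most every [1 / (n + 1)]. *)
Lemma continuous_proper {N} (f : point R N -> C) : continuous f -> proper f.
Proof.
  intros H x y E.
  assert (K : CRabs R (f x - f y) <= 0).
  { apply CR_le_eps with 1. intro n.
    destruct (H (rho x origin) (CR_of_Q R (1 # Pos.of_succ_nat n)))
      as [delta Hd K]; [apply CR_of_Q_lt; reflexivity|].
    rewrite CRplus_0_l, CRmult_1_l. apply K.
    - apply CRle_refl.
    - apply CRle_eq. apply rho_ext; [intro i; symmetry; apply E | intro; reflexivity].
    - apply CRle_trans with 0; [|apply CRlt_asym, Hd].
      rewrite (rho_ext x x y x (fun i => CReq_refl (x i)) (fun i => CReq_sym (x i) (y i) (E i))).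
      apply CRle_trans with (INR N * 0 : C); [|apply CRle_eq; ring].
      apply rho_le_coord; [apply CRle_refl|]. intro k.
      rewrite CRabs_right; [apply CRle_eq; ring | apply CRle_eq; ring]. }
  destruct (CRabs_def2 _ _ K) as [K1 K2]. split; [cle K2 | cle K1].
Qed.

(** * Comparison with the Riemann integral *)

(** For positive [r], the retraction of the line onto [-r, r]. Minimum and maximum replace a
    definition by cases, as the order of reals is not decidable. *)
Definition clamp (r v : C) : C := CRmax (- r) (CRmin r v).

Lemma clamp_ext r u v : u == v -> clamp r u == clamp r v.
Proof. intro E. unfold clamp. rewrite E. reflexivity. Qed.

Lemma clamp_low r v : 0 < r -> v <= - r -> clamp r v == - r.
Proof.
  intros Hr H. apply CRmax_left. exact (CRle_trans _ _ _ (CRmin_r _ _) H).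
Qed.

Lemma opp_pos_le (r : C) : 0 < r -> - r <= r.
Proof. intro Hr. apply CRlt_asym in Hr. cle (2 &* Hr). Qed.

Lemma clamp_high r v : 0 < r -> r <= v -> clamp r v == r.
Proof.
  intros Hr H. unfold clamp. rewrite (CRmin_left r v H). apply CRmax_right, opp_pos_le, Hr.
Qed.

Lemma clamp_id r v : - r <= v -> v <= r -> clamp r v == v.
Proof.
  intros H1 H2. unfold clamp. rewrite (CRmin_right r v H2). apply CRmax_right, H1.
Qed.

Lemma clamp_mono r u v : u <= v -> clamp r u <= clamp r v.
Proof.
  intro H. apply CRmax_lub; [apply CRmax_l|].
  refine (CRle_trans _ _ _ _ (CRmax_r _ _)). apply CRmin_glb; [apply CRmin_l|].
  exact (CRle_trans _ _ _ (CRmin_r _ _) H).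
Qed.

Lemma clamp_step r u v : u <= v -> clamp r v - clamp r u <= v - u.
Proof.
  intro H. apply CRle_trans with (CRabs R (v - u)).
  2:{ apply CRle_eq, CRabs_right. cle H. }
  apply (CRle_trans _ _ _ (CRle_abs _)). unfold clamp.
  rewrite (CRmax_sym (- r) (CRmin r v)), (CRmax_sym (- r) (CRmin r u)).
  apply (CRle_trans _ _ _ (CRmax_contract _ _ _)).
  rewrite (CRmin_sym r v), (CRmin_sym r u). apply CRmin_contract.
Qed.

Lemma fin_prod_nonneg {n} (f : Fin.t n -> C) : (forall i, 0 <= f i) -> 0 <= fin_prod f.
Proof.
  unfold fin_prod. induction n as [|n IH]; intro H; simpl;
    [apply CRlt_asym, CRzero_lt_one|].
  apply CRmult_le_0_compat; [apply H | apply IH; intro; apply H].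
Qed.

Lemma fin_prod_const {n} (f : Fin.t n -> C) a : (forall i, f i == a) -> fin_prod f == CRpow a n.
Proof.
  unfold fin_prod. induction n as [|n IH]; intro H; simpl; [reflexivity|].
  apply CRmult_morph; [apply H | apply IH; intro; apply H].
Qed.

Definition in_box {N} (c : point R N) (s : C) (x : point R N) : Prop :=
  forall k, c k <= x k <= c k + s.

Lemma in_box_norm {N} (c : point R N) s B x : 0 <= s -> 0 <= B ->
  (forall k, CRabs R (c k) <= B) -> in_box c s x -> rho x origin <= INR N * (B + s).
Proof.
  intros Hs H0 HB Hx. apply rho_le_coord; [cle (H0 &+ Hs)|].
  intro k. destruct (Hx k) as [H1 H2]. destruct (CRabs_def2 _ _ (HB k)) as [H3 H4].
  unfold origin. apply CRabs_le. split.
  - cle (H1 &+ H4 &+ Hs).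
  - cle (H2 &+ H3).
Qed.

Lemma not_in_cube_vanishes {N} (h : point R N -> C) r x k :
  vanishes_beyond h r -> r < CRabs R (x k) -> h x == 0.
Proof.
  intros H L. apply H. apply (CRlt_le_trans _ _ _ L).
  refine (CRle_trans _ _ _ _ (coord_le_rho x origin k)).
  unfold origin. apply CRle_eq, CRabs_morph. ring.
Qed.

Section Partition.
Context {N : nat}.
Variables (c : point R N) (r w : C) (J T : nat).
Hypotheses (Hr : 0 < r) (Hw : 0 < w).
Hypothesis HJ : forall k, c k - INR J * w <= - r.
Hypothesis HT : forall k, r <= c k + (INR (S T) - INR J) * w.

(* The nodes c_k + (i - J) w of a uniform grid, clamped to [-r, r]: the cells
   outside the cube degenerate, those inside are unchanged. *)
Definition grid_pos (k : Fin.t N) (i : nat) : C := c k + (INR i - INR J) * w.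

Lemma grid_pos_le k i : grid_pos k i <= grid_pos k (S i).
Proof.
  unfold grid_pos. rewrite INR_S. pose proof (CRlt_asym _ _ Hw) as K. cle K.
Qed.

(** The tag is the lower corner of the cell, so that inside the cube the Riemann sum uses the sample
    points of the dyadic average. *)
Definition clamped_grid : tagged_partition (fun _ : Fin.t N => - r) (fun _ => r).
Proof.
  refine {| last_cell := Vector.const T N;
            node := fun k i => clamp r (grid_pos k i);
            tag := fun j k => clamp r (grid_pos k (Vector.nth j k)) |}.
  - intro k. apply clamp_low; [exact Hr|]. unfold grid_pos.
    refine (CRle_trans _ _ _ _ (HJ k)). apply CRle_eq. unfold INR at 1. simpl. ring.
  - intro k. rewrite Vector.const_nth. apply clamp_high; [exact Hr | apply HT].
  - intros k i _. apply clamp_mono, grid_pos_le.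
  - intros j _ k. split; [apply CRle_refl | apply clamp_mono, grid_pos_le].
Defined.

Lemma clamped_grid_mesh : mesh_le clamped_grid w.
Proof.
  intros k i _. refine (CRle_trans _ _ _ (clamp_step r _ _ (grid_pos_le k i)) _).
  unfold grid_pos. rewrite INR_S. apply CRle_eq. ring.
Qed.

(** Since [<=] is a negation, the inequality may be assumed to fail. The right side is nonnegative,
    so [h y <= eps] is then impossible. But a cell leaving the cube has [h y <= eps]: either [h]
    vanishes at [y] itself or at a neighbouring corner. Hence the cell lies in the cube and has
    volume [w ^ N] and tag [y]. *)
Lemma clamped_grid_cell (h : point R N -> C) (eps : C) (j : Vector.t nat N) (y : point R N) :
  proper h -> (forall x, 0 <= h x) -> vanishes_beyond h r -> 0 <= eps ->
  (forall k, y k == grid_pos k (Vector.nth j k)) ->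
  (forall k y', y' k == y k + w -> (forall i, i <> k -> y' i == y i) -> h y <= h y' + eps) ->
  CRpow w N * (h y - eps) <=
  h (tag clamped_grid j) *
  fin_prod (fun k => node clamped_grid k (S (Vector.nth j k))
                     - node clamped_grid k (Vector.nth j k)).
Proof.
  intros Hp Hh Hv Heps Hy Hosc L.
  assert (W0 : 0 <= CRpow w N) by (apply CRpow_ge_zero, CRlt_asym, Hw).
  assert (R0 : 0 <= h (tag clamped_grid j) *
    fin_prod (fun k => node clamped_grid k (S (Vector.nth j k))
                     - node clamped_grid k (Vector.nth j k))).
  { apply CRmult_le_0_compat; [apply Hh|]. apply fin_prod_nonneg. intro k.
    pose proof (clamp_mono r _ _ (grid_pos_le k (Vector.nth j k))) as K. simpl. cle K. }
  assert (Small : h y <= eps -> False).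
  { intro K. refine (CRle_trans _ _ _ _ R0 L).
    apply CRle_minus in K.
    pose proof (CRmult_le_0_compat _ _ W0 K) as K'. cle K'. }
  assert (Low : forall k, - r <= y k).
  { intros k Lk. apply Small. rewrite (not_in_cube_vanishes h r y k Hv); [exact Heps|].
    apply CRlt_le_trans with (- y k); [|rewrite <- CRabs_opp; apply CRle_abs].
    clt Lk. }
  assert (High : forall k, y k + w <= r).
  { intros k Lk. apply Small.
    (* The neighbouring corner in direction [k], where [h] vanishes. *)
    set (y' := fun i => if Fin.eq_dec i k then y i + w else y i).
    assert (E : y' k == y k + w).
    { unfold y'. destruct (Fin.eq_dec k k); [reflexivity | congruence]. }
    refine (CRle_trans _ _ _ (Hosc k y' E _) _).
    - intros i Hi. unfold y'. destruct (Fin.eq_dec i k); [contradiction | reflexivity].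
    - rewrite (not_in_cube_vanishes h r y' k Hv); [apply CRle_eq; ring|].
      rewrite E. apply CRlt_le_trans with (y k + w); [exact Lk | apply CRle_abs]. }
  pose proof (CRlt_asym _ _ Hw) as w0.
  apply (CRle_refl (CRpow w N * (h y - eps))).
  refine (CRle_lt_trans _ _ _ _ L).
  assert (E0 : forall k, clamp r (grid_pos k (Vector.nth j k)) == y k).
  { intro k. rewrite <- (clamp_ext r _ _ (Hy k)). apply clamp_id; [apply Low|].
    cle (w0 &+ High k). }
  assert (E1 : forall k, clamp r (grid_pos k (S (Vector.nth j k))) == y k + w).
  { intro k. rewrite (clamp_ext r (grid_pos k (S (Vector.nth j k))) (y k + w)).
    - apply clamp_id; [|apply High]. cle (w0 &+ Low k).
    - rewrite (Hy k). unfold grid_pos. rewrite INR_S. ring. }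
  rewrite (fin_prod_const _ w).
  2:{ intro k. simpl. rewrite E0, E1. ring. }
  rewrite (Hp _ y E0).
  pose proof (CRmult_le_0_compat _ _ W0 Heps) as K. cle K.
Qed.
End Partition.

(** The dyadic grid of the box, continued on all sides beyond the cube of the integral, gives a
    Riemann sum that contains the average up to scaling; its other terms are nonnegative. One half
    of [eps] pays for the loss in the cell estimate, the other for the distance of the Riemann sum
    from [I]. *)
Lemma avg_le_integral {N} (h : point R N -> C) I (c : point R N) s :
  0 < s -> continuous h -> (forall x, 0 <= h x) -> is_riemann_integral h I ->
  forall eps, 0 < eps ->
  {m0 : nat & forall m, (m0 <= m)%nat ->
     CRpow s N * (avg (fun _ => m) h c (fun _ => s) - eps) <= I}.
Proof.
  intros Hs Hc Hh [r Hr [Hv HI]] eps Heps.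
  assert (V0 : 0 < CRpow s N) by (apply CRpow_gt_zero, Hs).
  assert (Heps2 : 0 < half * eps) by (clt ((1#2) <* Heps)).
  destruct (HI _ (CRmult_lt_0_compat R _ _ V0 Heps2)) as [d1 Hd1 HP].
  destruct (point_bound c) as [B HB0 HB].
  destruct (Hc (INR N * (B + s)) _ Heps2) as [d2 Hd2 Hosc].
  (* [m1] makes the mesh fine enough for the integral; [m2] brings neighbouring corners within the
     modulus of continuity of [h]. *)
  destruct (pw_small s d1 Hd1) as [m1 Hm1].
  destruct (pw_small (INR N * s) d2 Hd2) as [m2 Hm2].
  exists (Nat.max m1 m2). intros m Hm.
  specialize (Hm1 m ltac:(lia)). specialize (Hm2 m ltac:(lia)).
  set (w := pw m * s).
  assert (Hw : 0 < w) by (apply CRmult_lt_0_compat; [apply pw_pos | exact Hs]).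
  pose proof (CRlt_asym _ _ Hw) as w0. pose proof (CRlt_asym _ _ Hs) as s0.
  (* As [B] bounds the coordinates of [c], [J] further cells on each side reach the boundary of the
     cube. *)
  destruct (archimedean_mult (B + r) w Hw) as [J HJ].
  set (T := (J + 2 ^ m + J)%nat).
  assert (Ew : INR (2 ^ m) * w == s).
  { unfold w. rewrite <- CRmult_assoc, INR_pow2. ring. }
  assert (HJ' : forall k, c k - INR J * w <= - r).
  { intro k. pose proof (CRle_trans _ _ _ (CRle_abs _) (HB k)) as K. cle (K &+ HJ). }
  assert (HT' : forall k, r <= c k + (INR (S T) - INR J) * w).
  { intro k. destruct (CRabs_def2 _ _ (HB k)) as [_ K].
    unfold T. rewrite INR_S, !INR_plus.
    setoid_replace (c k + (INR J + INR (2 ^ m) + INR J + 1 - INR J) * w)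
      with (c k + INR J * w + INR (2 ^ m) * w + w) by ring.
    rewrite Ew. cle (K &+ HJ &+ w0 &+ s0). }
  specialize (HP (clamped_grid c r w J T Hr Hw HJ' HT')).
  assert (HM : mesh_le (clamped_grid c r w J T Hr Hw HJ' HT') d1).
  { intros k i Hi. refine (CRle_trans _ _ _ (clamped_grid_mesh c r w J T Hr Hw HJ' HT' k i Hi) _).
    unfold w. cle Hm1. }
  specialize (HP HM). apply CRabs_def2 in HP. destruct HP as [HP _].
  pose proof (continuous_proper h Hc) as Hp.
  assert (Main : avg (fun _ => m)
      (fun x => CRpow w N * h x + - (CRpow w N * (half * eps))) c (fun _ => s)
    <= CRpow (pw m) N * riemann_sum h (clamped_grid c r w J T Hr Hw HJ' HT')).
  { unfold riemann_sum. apply avg_le_grid_sum with (J := J).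
    - unfold T; lia.
    - intro j. apply CRmult_le_0_compat; [apply Hh|]. apply fin_prod_nonneg. intro k.
      pose proof (clamp_mono r _ _ (grid_pos_le c w J Hw k (Vector.nth j k))) as K.
      simpl. cle K.
    - intros x y E. rewrite (Hp x y E). reflexivity.
    - intros j Hj. fold w.
      set (y := fun k => c k + INR (Vector.nth j k - J) * w).
      assert (Hcoef : forall k, INR (Vector.nth j k - J) * w + w <= s).
      { intro k. rewrite <- Ew.
        assert (K : INR (S (Vector.nth j k - J)) * w <= INR (2 ^ m) * w).
        { apply CRmult_le_compat_r; [exact w0|]. apply CR_of_Q_le.
          specialize (Hj k). unfold Qle, Qnum, Qden. lia. }
        rewrite INR_S in K. cle K. }
      assert (Hcoef0 : forall k, 0 <= INR (Vector.nth j k - J) * w).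
      { intro k. apply CRmult_le_0_compat; [apply INR_nonneg | exact w0]. }
      refine (CRle_trans _ _ _ _
        (clamped_grid_cell c r w J T Hr Hw HJ' HT' h (half * eps) j y Hp Hh Hv
           (CRlt_asym _ _ Heps2) _ _)).
      + apply CRle_eq. ring.
      + intro k. unfold y, grid_pos.
        assert (E : @INR R (Vector.nth j k) == INR J + INR (Vector.nth j k - J)).
        { rewrite <- INR_plus. replace (J + (Vector.nth j k - J))%nat with (Vector.nth j k).
          - reflexivity.
          - specialize (Hj k). lia. }
        rewrite E. ring.
      + intros k y' E E'.
        assert (By : in_box c s y).
        { intro i. unfold y. split; [cle (Hcoef0 i) | cle (Hcoef i &+ w0)]. }
        assert (By' : in_box c s y').
        { intro i. destruct (Fin.eq_dec i k) as [->|n].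
          - rewrite E. unfold y. split; [cle (Hcoef0 k &+ w0) | cle (Hcoef k)].
          - rewrite (E' i n). apply By. }
        assert (K : CRabs R (h y - h y') <= half * eps).
        { apply Hosc; try (apply (in_box_norm c s); assumption).
          apply CRle_trans with (INR N * w).
          2:{ unfold w. cle Hm2. }
          apply rho_le_coord; [exact w0|]. intro i.
          destruct (Fin.eq_dec i k) as [->|n].
          - rewrite E. apply CRabs_le. split; [apply CRle_eq; ring | cle (2 &* w0)].
          - rewrite (E' i n). apply CRabs_le. split; cle w0. }
        apply CRabs_def2 in K. destruct K as [K _]. cle K. }
  rewrite avg_linear, avg_const in Main.
  (* A cell is [(pw m) ^ N] times the box in volume, and this factor cancels. *)
  assert (EW : CRpow w N == CRpow (pw m) N * CRpow s N)
    by (unfold w; rewrite CRpow_mult; reflexivity).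
  assert (Main' : CRpow s N * (avg (fun _ => m) h c (fun _ => s) - half * eps)
     <= riemann_sum h (clamped_grid c r w J T Hr Hw HJ' HT')).
  { apply CRmult_le_reg_l with (CRpow (pw m) N); [apply CRpow_gt_zero, pw_pos|].
    refine (CRle_trans _ _ _ _ Main). apply CRle_eq. rewrite EW. ring. }
  cle (Main' &+ HP).
Qed.

(** * A point where a sequence of functions with small means is small *)

Lemma series_lt_le (u v : nat -> C) x : (forall n, 0 <= u n) -> (forall n, u n <= v n) ->
  series_cv_lim_lt v x -> series_cv_lim_lt u x.
Proof.
  intros H0 H. apply series_cv_abs_lt. intro n. rewrite CRabs_right; [apply H | apply H0].
Qed.

(** Both series converge by comparison with [2 u], and their sums satisfy [a + b <= 2 l].
    Cotransitivity of [l < x] at [a] decides: either [a < x], or [l < a] and then [b < l < x]. *)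
Lemma series_halves (u v v' : nat -> C) x : (forall n, 0 <= v n) -> (forall n, 0 <= v' n) ->
  (forall n, half * (v n + v' n) <= u n) -> series_cv_lim_lt u x ->
  series_cv_lim_lt v x + series_cv_lim_lt v' x.
Proof.
  intros Hv Hv' H [l [Hl Hx]].
  pose proof (series_cv_scale (CR_of_Q R 2) _ _ Hl) as Hl2.
  destruct (series_cv_maj v (fun n => u n * CR_of_Q R 2) _
    ltac:(intro n; rewrite CRabs_right by apply Hv; cle (Hv' n &+ 2 &* H n)) Hl2) as [a [Ha _]].
  destruct (series_cv_maj v' (fun n => u n * CR_of_Q R 2) _
    ltac:(intro n; rewrite CRabs_right by apply Hv'; cle (Hv n &+ 2 &* H n)) Hl2) as [b [Hb _]].
  assert (S2 : a + b <= l * CR_of_Q R 2).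
  { refine (CR_cv_le _ _ _ _ _ (series_cv_plus _ _ _ _ Ha Hb) Hl2).
    intro n. apply sum_Rle. intros k _. cle (2 &* H k). }
  destruct (CRltLinear R) as [_ split]. destruct (split l a x Hx) as [L|L].
  - right. exists b. split; [exact Hb|]. refine (CRle_lt_trans _ l _ _ Hx).
    apply CRlt_asym in L. cle (S2 &+ L).
  - left. exists a. split; assumption.
Qed.

(** The intervals from [a l] to [a l + pw l * s] are nested. This serves both the descent to a point
    of a full set and the bisection for the distance. *)
Lemma nested_limit (a : nat -> C) s : 0 <= s ->
  (forall l, a l <= a (S l) /\ a (S l) <= a l + pw (S l) * s) ->
  {x : C & forall l, a l <= x /\ x <= a l + pw l * s}.
Proof.
  intros Hs H.
  assert (M : forall l d, a l <= a (l + d)%nat /\ a (l + d)%nat + pw (l + d) * s <= a l + pw l * s).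
  { intros l d. induction d as [|d [IH1 IH2]].
    - rewrite Nat.add_0_r. split; apply CRle_refl.
    - rewrite Nat.add_succ_r. destruct (H (l + d)%nat) as [H1 H2].
      split; [exact (CRle_trans _ _ _ IH1 H1)|].
      rewrite pw_S in H2 |- *. cle (IH2 &+ H2). }
  assert (M' : forall n i, (n <= i)%nat -> a n <= a i /\ a i <= a n + pw n * s).
  { intros n i Hi. destruct (M n (i - n)%nat) as [M1 M2].
    replace (n + (i - n))%nat with i in M1, M2 by lia. split; [exact M1|].
    pose proof (CRmult_le_0_compat _ _ (pw_nonneg i) Hs) as K. cle (M2 &+ K). }
  assert (Cau : CR_cauchy R a).
  { intro p. destruct (pw_small s (CR_of_Q R (1 # p))) as [n Hn];
      [apply CR_of_Q_lt; reflexivity|].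
    exists n. intros i j Hi Hj. destruct (M' n i Hi) as [A1 A2]. destruct (M' n j Hj) as [B1 B2].
    specialize (Hn n (Nat.le_refl n)).
    apply CRabs_le. split; [cle (A1 &+ B2 &+ Hn) | cle (B1 &+ A2 &+ Hn)]. }
  destruct (CR_complete R a Cau) as [x Hx]. exists x. intro l. split.
  - apply (CR_cv_bound_down a _ _ l); [|exact Hx]. intros n Hn. apply (M' l n Hn).
  - apply (CR_cv_bound_up a _ _ l); [|exact Hx]. intros n Hn. apply (M' l n Hn).
Qed.

Section Descent.
Context {N : nat}.
Variables (s : C) (g : nat -> point R N -> C) (weight : nat -> C) (depth : nat -> nat).
Hypotheses (Hs : 0 < s) (Hproper : forall k, proper (g k)) (Hpos : forall k x, 0 <= g k x)
  (Hweight : forall k, 0 <= weight k).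

(* At resolution depth k, the weighted mean of g k over the dyadic box of level
   l and corner c; beyond that resolution g k is no longer tracked. *)
Definition level_mean (l : nat) (c : point R N) (k : nat) : C :=
  if (l <=? depth k)%nat
  then weight k * avg (fun _ => (depth k - l)%nat) (g k) c (fun _ => pw l * s) else 0.

Definition fin_val (j : Fin.t N) : nat := proj1_sig (Fin.to_nat j).

(* The same when the first i coordinates have already been halved once more. *)
Definition partial_mean (l i : nat) (c : point R N) (k : nat) : C :=
  if (l <? depth k)%nat
  then weight k *
       avg (fun j => if (fin_val j <? i)%nat then (depth k - S l)%nat else (depth k - l)%nat)
         (g k) c (fun j => if (fin_val j <? i)%nat then pw (S l) * s else pw l * s)
  else 0.

Lemma partial_mean_nonneg l i c k : 0 <= partial_mean l i c k.
Proof.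
  unfold partial_mean. destruct (l <? depth k)%nat; [|apply CRle_refl].
  apply CRmult_le_0_compat; [apply Hweight | apply avg_nonneg; intro; apply Hpos].
Qed.

Lemma level_mean_nonneg l c k : 0 <= level_mean l c k.
Proof.
  unfold level_mean. destruct (l <=? depth k)%nat; [|apply CRle_refl].
  apply CRmult_le_0_compat; [apply Hweight | apply avg_nonneg; intro; apply Hpos].
Qed.

(** Equality except at [l = depth k], where [g k] is dropped because its grid admits no further
    halving. *)
Lemma partial_mean_first l c k : partial_mean l 0 c k <= level_mean l c k.
Proof.
  unfold partial_mean, level_mean.
  destruct (Nat.ltb_spec l (depth k)); destruct (Nat.leb_spec l (depth k)); try lia.
  - apply CRmult_le_compat_l; [apply Hweight|]. apply CRle_eq.
    apply avg_ext; [apply Hproper | | |]; intro j; reflexivity.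
  - apply CRmult_le_0_compat; [apply Hweight | apply avg_nonneg; intro; apply Hpos].
  - apply CRle_refl.
Qed.

Lemma partial_mean_last l c k : level_mean (S l) c k <= partial_mean l N c k.
Proof.
  unfold partial_mean, level_mean.
  destruct (Nat.ltb_spec l (depth k)); destruct (Nat.leb_spec (S l) (depth k)); try lia;
    [|apply CRle_refl].
  apply CRmult_le_compat_l; [apply Hweight|]. apply CRle_eq.
  apply avg_ext; [apply Hproper | | |]; intro j; try reflexivity;
    unfold fin_val; destruct (Fin.to_nat j) as [v Hv]; simpl;
    destruct (Nat.ltb_spec v N); try lia; reflexivity.
Qed.

(** By [avg_split] each tracked mean is the mean of those over the two halves in direction [i]. So
    [series_halves] selects a half on which the sum stays below 1; the corner stays or moves by half
    a side. *)
Lemma partial_mean_step l i c : (i < N)%nat ->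
  series_cv_lim_lt (partial_mean l i c) 1 ->
  {c' : point R N & series_cv_lim_lt (partial_mean l (S i) c') 1 &
    forall j, c j <= c' j /\
      c' j <= c j + (if (fin_val j =? i)%nat then pw (S l) * s else 0)}.
Proof.
  intros Hi HS.
  set (c' := fun j => c j + (if (fin_val j =? i)%nat then pw (S l) * s else 0)).
  set (kk := Fin.of_nat_lt Hi).
  assert (Ekk : fin_val kk = i) by (unfold fin_val, kk; rewrite Fin.to_nat_of_nat; reflexivity).
  assert (Ne : forall j, j <> kk -> fin_val j <> i).
  { intros j Hj E. apply Hj, Fin.to_nat_inj. rewrite <- Ekk in E. exact E. }
  assert (P : forall j, 0 <= (if (fin_val j =? i)%nat then pw (S l) * s else 0)).
  { intro j. destruct (fin_val j =? i)%nat; [|apply CRle_refl].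
    apply CRmult_le_0_compat; [apply pw_nonneg | apply CRlt_asym, Hs]. }
  destruct (series_halves (partial_mean l i c) (partial_mean l (S i) c)
    (partial_mean l (S i) c') 1) as [L|L]; try (intro; apply partial_mean_nonneg).
  - intro k. unfold partial_mean. destruct (Nat.ltb_spec l (depth k)); [|apply CRle_eq; ring].
    rewrite (avg_split kk
      (fun j => if (fin_val j <? i)%nat then (depth k - S l)%nat else (depth k - l)%nat)
      (fun j => if (fin_val j <? S i)%nat then (depth k - S l)%nat else (depth k - l)%nat)
      (g k) c c' _ (fun j => if (fin_val j <? S i)%nat then pw (S l) * s else pw l * s)).
    + apply CRle_eq. ring.
    + apply Hproper.
    + rewrite Ekk. destruct (Nat.ltb_spec i i); destruct (Nat.ltb_spec i (S i)); lia.
    + intros j Hj. specialize (Ne j Hj).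
      destruct (Nat.ltb_spec (fin_val j) i); destruct (Nat.ltb_spec (fin_val j) (S i)); lia.
    + unfold c'. rewrite Ekk, Nat.eqb_refl. destruct (Nat.ltb_spec i (S i)); [reflexivity | lia].
    + intros j Hj. unfold c'. destruct (Nat.eqb_spec (fin_val j) i) as [E|E];
        [destruct (Ne j Hj E) | ring].
    + rewrite Ekk. destruct (Nat.ltb_spec i i); destruct (Nat.ltb_spec i (S i)); try lia.
      rewrite pw_S. ring.
    + intros j Hj. specialize (Ne j Hj).
      destruct (Nat.ltb_spec (fin_val j) i); destruct (Nat.ltb_spec (fin_val j) (S i));
        try lia; reflexivity.
  - exact HS.
  - exists c; [exact L|]. intro j. split; [apply CRle_refl|]. cle (P j).
  - exists c'; [exact L|]. intro j. split; [|apply CRle_refl]. unfold c'. cle (P j).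
Qed.

Lemma level_mean_partial l c i : (i <= N)%nat ->
  series_cv_lim_lt (level_mean l c) 1 ->
  {c' : point R N & series_cv_lim_lt (partial_mean l i c') 1 &
    forall j, c j <= c' j /\
      c' j <= c j + (if (fin_val j <? i)%nat then pw (S l) * s else 0)}.
Proof.
  intros Hi HS. induction i as [|i IH].
  - exists c.
    + refine (series_lt_le _ _ _ _ _ HS); intro k;
        [apply partial_mean_nonneg | apply partial_mean_first].
    + intro j. split; [apply CRle_refl | apply CRle_eq]. simpl. ring.
  - destruct IH as [c1 H1 B1]; [lia|].
    destruct (partial_mean_step l i c1 Hi H1) as [c2 H2 B2].
    exists c2; [exact H2|]. intro j. destruct (B1 j) as [A1 A2]. destruct (B2 j) as [A3 A4].
    split; [exact (CRle_trans _ _ _ A1 A3)|].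
    apply (CRle_trans _ _ _ A4).
    destruct (Nat.ltb_spec (fin_val j) i); destruct (Nat.ltb_spec (fin_val j) (S i));
      destruct (Nat.eqb_spec (fin_val j) i); try lia; cle A2.
Qed.

Lemma level_mean_step l c :
  series_cv_lim_lt (level_mean l c) 1 ->
  {c' : point R N & series_cv_lim_lt (level_mean (S l) c') 1 &
    forall j, c j <= c' j /\ c' j <= c j + pw (S l) * s}.
Proof.
  intro HS. destruct (level_mean_partial l c N (Nat.le_refl N) HS) as [c' H B].
  exists c'.
  - refine (series_lt_le _ _ _ _ _ H); intro k;
      [apply level_mean_nonneg | apply partial_mean_last].
  - intro j. specialize (B j). unfold fin_val in B.
    destruct (Fin.to_nat j) as [v Hv]; simpl in B.
    destruct (Nat.ltb_spec v N); [exact B | lia].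
Qed.

(** At level [depth k] the average of [g k] has depth 0 and is its value at the corner of the
    current box. This is one term of a nonnegative series with sum below 1. The limit [x] need not
    be that corner, which is therefore returned as a nearby point [y]. *)
Lemma descent c : series_cv_lim_lt (level_mean 0 c) 1 ->
  {x : point R N & in_box c s x &
    forall k, {y : point R N & in_box c s y /\ weight k * g k y <= 1 &
      forall j, CRabs R (x j - y j) <= pw (depth k) * s}}.
Proof.
  intro HS.
  set (path := nat_rect (fun l => {c : point R N & series_cv_lim_lt (level_mean l c) 1})
    (existT _ c HS)
    (fun l p => match level_mean_step l (projT1 p) (projT2 p) with
                | existT2 _ _ c' H _ => existT _ c' H end)).
  set (corner := fun l => projT1 (path l)).
  assert (Step : forall l j, corner l j <= corner (S l) j /\
                             corner (S l) j <= corner l j + pw (S l) * s).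
  { intros l j. unfold corner. change (path (S l)) with
      (match level_mean_step l (projT1 (path l)) (projT2 (path l)) with
       | existT2 _ _ c' H _ => existT (fun c => series_cv_lim_lt (level_mean (S l) c) 1) c' H end).
    destruct (level_mean_step l (projT1 (path l)) (projT2 (path l))) as [c' H B]. exact (B j). }
  pose proof (CRlt_asym _ _ Hs) as s0.
  assert (L : forall j, {x : C & forall l, corner l j <= x /\ x <= corner l j + pw l * s}).
  { intro j. apply nested_limit; [exact s0|]. intro l. apply Step. }
  assert (Up : forall l j, c j <= corner l j /\ corner l j + pw l * s <= c j + s).
  { intros l j. induction l as [|l [IH1 IH2]].
    - split; [apply CRle_refl | apply CRle_eq]. change (c j + 1 * s == c j + s). ring.
    - destruct (Step l j) as [S1 S2]. split; [exact (CRle_trans _ _ _ IH1 S1)|].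
      rewrite pw_S in S2 |- *. cle (IH2 &+ S2). }
  exists (fun j => projT1 (L j)).
  - intro j. destruct (L j) as [x Hx]; simpl. destruct (Hx O) as [H1 H2].
    split; [exact H1|]. refine (CRle_trans _ _ _ H2 _). apply CRle_eq.
    change (c j + 1 * s == c j + s). ring.
  - intro k. exists (corner (depth k)).
    + split.
      * intro j. destruct (Up (depth k) j) as [U1 U2]. split; [exact U1|].
        pose proof (CRmult_le_0_compat _ _ (pw_nonneg (depth k)) s0) as K. cle (U2 &+ K).
      * destruct (projT2 (path (depth k))) as [l [HS1 HS2]].
        assert (E : level_mean (depth k) (corner (depth k)) k
                    == weight k * g k (corner (depth k))).
        { unfold level_mean. rewrite Nat.leb_refl, Nat.sub_diag, avg_depth0; [reflexivity|].
          apply Hproper. }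
        rewrite <- E. apply CRle_trans with l; [|apply CRlt_asym, HS2].
        apply CRle_trans with (CRsum (level_mean (depth k) (corner (depth k))) k).
        -- apply selectOneInSum; [lia | intro; apply level_mean_nonneg].
        -- apply growing_ineq; [|exact HS1]. intro n. simpl.
           pose proof (level_mean_nonneg (depth k) (corner (depth k)) (S n)) as K. cle K.
    + intro j. destruct (L j) as [x Hx]; simpl. destruct (Hx (depth k)) as [H1 H2].
      pose proof (CRmult_le_0_compat _ _ (pw_nonneg (depth k)) s0) as K.
      apply CRabs_le. split; [cle (H1 &+ K) | cle H2].
Qed.
End Descent.

(* The last clause bounds the oscillation of h on the cells of the grid, so that
   the value at the corner of a cell controls h on the whole cell. *)
Definition mean_bounded {N} (c : point R N) (s : C) (h : point R N -> C) (I : C) : Type :=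
  proper h * (forall x, 0 <= h x) *
  (forall eps, 0 < eps -> {m0 : nat & forall m, (m0 <= m)%nat ->
     CRpow s N * (avg (fun _ => m) h c (fun _ => s) - eps) <= I /\
     forall x y, in_box c s x -> in_box c s y ->
       (forall k, CRabs R (x k - y k) <= pw m * s) -> h x <= h y + eps}).

Lemma mean_bounded_integral {N} (h : point R N -> C) I (c : point R N) s :
  0 < s -> continuous h -> (forall x, 0 <= h x) -> is_riemann_integral h I ->
  mean_bounded c s h I.
Proof.
  intros Hs Hc Hh HI. split; [split; [apply continuous_proper, Hc | exact Hh]|].
  intros eps Heps. destruct (avg_le_integral h I c s Hs Hc Hh HI eps Heps) as [m1 H1].
  destruct (point_bound c) as [B HB0 HB].
  destruct (Hc (INR N * (B + s)) _ Heps) as [d Hd Hosc].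
  destruct (pw_small (INR N * s) d Hd) as [m2 Hm2].
  exists (Nat.max m1 m2). intros m Hm. split; [apply H1; lia|].
  pose proof (CRlt_asym _ _ Hs) as s0.
  intros x y Hx Hy Hxy. assert (K : CRabs R (h x - h y) <= eps).
  { apply Hosc; try (apply (in_box_norm c s); assumption).
    specialize (Hm2 m ltac:(lia)).
    apply CRle_trans with (INR N * (pw m * s)); [|cle Hm2].
    apply rho_le_coord; [|exact Hxy].
    apply CRmult_le_0_compat; [apply pw_nonneg | exact s0]. }
  apply CRabs_def2 in K. destruct K as [K _]. cle K.
Qed.

Lemma mean_bounded_zero {N} (c : point R N) s : 0 <= s -> mean_bounded c s (fun _ => 0) 0.
Proof.
  intro Hs. split; [split; [intros x y _; reflexivity | intro; apply CRle_refl]|].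
  intros eps Heps. exists O. intros m _. apply CRlt_asym in Heps. split.
  - rewrite avg_const.
    pose proof (CRmult_le_0_compat _ _ (CRpow_ge_zero s N Hs) Heps) as K. cle K.
  - intros. cle Heps.
Qed.

Lemma mean_bounded_plus {N} (c : point R N) s h h' I I' :
  mean_bounded c s h I -> mean_bounded c s h' I' ->
  mean_bounded c s (fun x => h x + h' x) (I + I').
Proof.
  intros [[P1 Q1] M1] [[P2 Q2] M2]. split; [split|].
  - intros x y E. rewrite (P1 x y E), (P2 x y E). reflexivity.
  - intro x. cle (Q1 x &+ Q2 x).
  - intros eps Heps. assert (Heps2 : 0 < half * eps) by (clt ((1#2) <* Heps)).
    destruct (M1 _ Heps2) as [m1 H1]. destruct (M2 _ Heps2) as [m2 H2].
    exists (Nat.max m1 m2). intros m Hm.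
    destruct (H1 m ltac:(lia)) as [A1 B1]. destruct (H2 m ltac:(lia)) as [A2 B2]. split.
    + rewrite (avg_ext _ (fun _ => m) _ (fun x => 1 * h x + h' x) _ c _ (fun _ => s)).
      * rewrite avg_linear. cle (A1 &+ A2).
      * intros x y E. rewrite (P1 x y E), (P2 x y E). ring.
      * reflexivity.
      * intro; reflexivity.
      * intro; reflexivity.
    + intros x y Hx Hy Hxy. cle (B1 x y Hx Hy Hxy &+ B2 x y Hx Hy Hxy).
Qed.

Lemma CRpow_two_half k : CRpow (CR_of_Q R 2) k * pw k == 1.
Proof.
  rewrite CRpow_mult. rewrite (CRpow_proper _ 1 k), CRpow_one; [reflexivity | ring].
Qed.

(** With [q k = 4^-k / 16] the mean of [g k] is at most [2 q k]. Weighted by [2^k] it is at most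
    [2^-k / 8], and these bounds add up to 1/4. The descent yields [g k y <= 2^-k] at some [y] near
    [x], and passing to [x] costs at most [q k <= 2^-k]. *)
Lemma small_point {N} (c : point R N) s (g : nat -> point R N -> C) (I : nat -> C) :
  0 < s -> (forall k, mean_bounded c s (g k) (I k)) ->
  (forall k, I k <= CRpow s N * (CR_of_Q R (1 # 16) * (pw k * pw k))) ->
  {x : point R N & in_box c s x & forall k, g k x <= CR_of_Q R 2 * pw k}.
Proof.
  intros Hs Hg HI.
  set (q := fun k => CR_of_Q R (1 # 16) * (pw k * pw k)).
  assert (Hq : forall k, 0 < q k).
  { intro k. apply CRmult_lt_0_compat; [apply CR_of_Q_lt; reflexivity|].
    apply CRmult_lt_0_compat; apply pw_pos. }
  (* Fine enough that both the error of the average and the oscillation on cells are at most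
     [q k]. *)
  pose (depth := fun k => projT1 (snd (Hg k) (q k) (Hq k))).
  assert (Hdepth : forall k,
     CRpow s N * (avg (fun _ => depth k) (g k) c (fun _ => s) - q k) <= I k /\
     forall x y, in_box c s x -> in_box c s y ->
       (forall j, CRabs R (x j - y j) <= pw (depth k) * s) -> g k x <= g k y + q k).
  { intro k. unfold depth. destruct (snd (Hg k) (q k) (Hq k)) as [m0 H]; simpl. apply H. lia. }
  set (weight := CRpow (CR_of_Q R 2)).
  assert (Hw : forall k, 0 <= weight k).
  { intro k. apply CRpow_ge_zero, CR_of_Q_le. discriminate. }
  assert (Hp : forall k, proper (g k)) by (intro k; apply (Hg k)).
  assert (H0 : forall k x, 0 <= g k x) by (intro k; apply (Hg k)).
  destruct (descent s g weight depth Hs Hp H0 Hw c) as [x Hx HX].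
  - apply (series_lt_le _ (fun k => pw k * CR_of_Q R (1 # 8))).
    + intro k. apply level_mean_nonneg; assumption.
    + intro k. unfold level_mean. cbn [Nat.leb]. rewrite Nat.sub_0_r.
      rewrite (avg_ext _ (fun _ => depth k) _ (g k) _ c _ (fun _ => s) (Hp k));
        try (intro; reflexivity).
      2:{ intro; simpl; ring. }
      destruct (Hdepth k) as [K _].
      pose proof (CRle_trans _ _ _ K (HI k)) as K'.
      apply CRmult_le_reg_l in K'; [|apply CRpow_gt_zero, Hs].
      assert (K2 : avg (fun _ => depth k) (g k) c (fun _ => s) <= q k + q k)
        by (unfold q at 2; cle K').
      apply (CRmult_le_compat_l (weight k)) in K2; [|apply Hw].
      apply (CRle_trans _ _ _ K2). apply CRle_eq.
      transitivity (weight k * pw k * pw k * CR_of_Q R (1 # 8)); [unfold q; ring|].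
      unfold weight. rewrite CRpow_two_half. ring.
    + exists (CR_of_Q R 2 * CR_of_Q R (1 # 8)). split.
      * apply series_cv_scale, GeoHalfTwo.
      * rewrite <- CR_of_Q_mult. apply CR_of_Q_lt. reflexivity.
  - exists x; [exact Hx|]. intro k. destruct (HX k) as [y [Hy Hy1] Hxy].
    destruct (Hdepth k) as [_ K]. specialize (K x y Hx Hy Hxy).
    apply (CRmult_le_compat_l (pw k)) in Hy1; [|apply pw_nonneg].
    setoid_replace (pw k * (weight k * g k y)) with (weight k * pw k * g k y) in Hy1 by ring.
    unfold weight in Hy1. rewrite CRpow_two_half in Hy1.
    assert (Kq : q k <= pw k).
    { unfold q. apply CRle_trans with (pw k * 1); [|apply CRle_eq; ring].
      apply CRle_trans with (pw k * (CR_of_Q R (1 # 16) * pw k)); [apply CRle_eq; ring|].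
      apply CRmult_le_compat_l; [apply pw_nonneg|].
      assert (pw k <= 1).
      { clear. induction k as [|k IH]; [apply CRle_refl|]. rewrite pw_S.
        pose proof (@CRzero_lt_one R) as Z. apply CRlt_asym in Z. cle ((1#2) &* IH &+ (1#2) &* Z). }
      pose proof (@CRzero_lt_one R) as Z. apply CRlt_asym in Z.
      cle ((1#16) &* H &+ (15#16) &* Z). }
    cle (K &+ Hy1 &+ Kq).
Qed.

(** * Full sets meet every box *)

Lemma mean_bounded_sum {N} (c : point R N) s (h : nat -> point R N -> C) (I : nat -> C) a n :
  0 <= s -> (forall k, mean_bounded c s (h k) (I k)) ->
  mean_bounded c s (fun x => sum_lt (fun i => h (a + i)%nat x) n)
    (sum_lt (fun i => I (a + i)%nat) n).
Proof.
  intros Hs H. induction n as [|n IH]; simpl.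
  - apply mean_bounded_zero, Hs.
  - apply (mean_bounded_plus c s _ _ _ _ IH (H (a + n)%nat)).
Qed.

Lemma block_sum (u : nat -> C) i j : (i <= j)%nat ->
  CRsum u j == CRsum u i + sum_lt (fun k => u (S i + k)%nat) (j - i).
Proof.
  intro H. rewrite !CRsum_sum_lt. replace (S j) with (S i + (j - i))%nat by lia.
  rewrite sum_lt_add. reflexivity.
Qed.

(** The series is cut at indices [M k] so far out that block [k] of the [I n] adds up to at most
    [e k]. Then [small_point] bounds block [k] of the [h n x] by [2 * 2^-k], which makes the partial
    sums at [x] Cauchy. *)
Lemma convergence_point {N} (c : point R N) s (h : nat -> point R N -> C) (I : nat -> C) l :
  0 < s -> (forall n, mean_bounded c s (h n) (I n)) -> series_cv I l ->
  {x : point R N & in_box c s x & {S : C & series_cv (fun n => h n x) S}}.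
Proof.
  intros Hs Hh HI. pose proof (CRlt_asym _ _ Hs) as s0.
  set (e := fun k => CRpow s N * (CR_of_Q R (1 # 16) * (pw k * pw k))).
  assert (He : forall k, 0 < half * e k).
  { intro k. apply CRmult_lt_0_compat; [apply CR_of_Q_lt; reflexivity|].
    apply CRmult_lt_0_compat; [apply CRpow_gt_zero, Hs|].
    apply CRmult_lt_0_compat; [apply CR_of_Q_lt; reflexivity|].
    apply CRmult_lt_0_compat; apply pw_pos. }
  pose (rank := fun k => projT1 (Un_cv_nat_real _ _ HI _ (He k))).
  assert (Hrank : forall k i, (rank k <= i)%nat -> CRabs R (CRsum I i - l) < half * e k)
    by (intro k; exact (projT2 (Un_cv_nat_real _ _ HI _ (He k)))).
  (* Both ends of block [k] lie past [rank k], each contributing an error [e k / 2]; the maximum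
     with [S Mk] keeps [M] strictly increasing. *)
  set (M := nat_rect (fun _ => nat) (rank O) (fun k Mk => Nat.max (S Mk) (rank (S k)))).
  assert (HM : forall k, (rank k <= M k)%nat).
  { intros [|k]; [apply Nat.le_refl | apply Nat.le_max_r]. }
  assert (HMS : forall k, (M k < M (S k))%nat) by (intro k; apply Nat.le_max_l).
  destruct (small_point c s
    (fun k x => sum_lt (fun i => h (S (M k) + i)%nat x) (M (S k) - M k))
    (fun k => sum_lt (fun i => I (S (M k) + i)%nat) (M (S k) - M k)) Hs) as [x Hx Hsmall].
  - intro k. apply mean_bounded_sum; assumption.
  - intro k. fold (e k).
    assert (E : CRsum I (M (S k)) == CRsum I (M k) +
              sum_lt (fun i => I (S (M k) + i)%nat) (M (S k) - M k))
      by (apply block_sum, Nat.lt_le_incl, HMS).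
    assert (K1 : CRabs R (CRsum I (M k) - l) <= half * e k)
      by (apply CRlt_asym, Hrank, HM).
    assert (K2 : CRabs R (CRsum I (M (S k)) - l) <= half * e k).
    { apply CRlt_asym, Hrank. pose proof (HM k). pose proof (HMS k). lia. }
    apply CRabs_def2 in K1. apply CRabs_def2 in K2.
    destruct K1 as [_ K1], K2 as [K2 _]. rewrite E in K2. cle (K1 &+ K2).
  - exists x; [exact Hx|]. apply CR_complete.
    assert (H0 : forall n, 0 <= h n x) by (intro n; apply (Hh n)).
    (* The bound [2 * 2^-k] is the drop from [4 * 2^-k] to [4 * 2^-(k+1)], so the sum up to [M k]
       plus [4 * 2^-k] does not increase with [k]. *)
    assert (Hblock : forall k d, CRsum (fun n => h n x) (M (k + d)%nat) + CR_of_Q R 4 * pw (k + d)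
       <= CRsum (fun n => h n x) (M k) + CR_of_Q R 4 * pw k).
    { intros k d. induction d as [|d IH].
      - rewrite Nat.add_0_r. apply CRle_refl.
      - rewrite Nat.add_succ_r, pw_S.
        rewrite (block_sum _ (M (k + d)%nat) (M (S (k + d)))) by apply Nat.lt_le_incl, HMS.
        cle (Hsmall (k + d)%nat &+ IH). }
    assert (HMk : forall k, (k <= M k)%nat).
    { intro k. induction k; [lia|]. pose proof (HMS k). lia. }
    assert (Hbd : forall k i, (M k <= i)%nat ->
       CRsum (fun n => h n x) (M k) <= CRsum (fun n => h n x) i /\
       CRsum (fun n => h n x) i <= CRsum (fun n => h n x) (M k) + CR_of_Q R 4 * pw k).
    { intros k i Hi. split; [apply pos_sum_more; assumption|].
      apply CRle_trans with (CRsum (fun n => h n x) (M (k + i)%nat)).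
      - apply pos_sum_more; [assumption|]. pose proof (HMk (k + i)%nat). lia.
      - cle (Hblock k i &+ 4 &* (pw_nonneg (k + i))). }
    intro p. destruct (pw_small (CR_of_Q R 4) (CR_of_Q R (1 # p))) as [k Hk];
      [apply CR_of_Q_lt; reflexivity|].
    exists (M k). intros i j Hi Hj. specialize (Hk k (Nat.le_refl k)).
    destruct (Hbd k i Hi) as [A1 A2], (Hbd k j Hj) as [B1 B2].
    apply CRabs_le. split; [cle (A1 &+ B2 &+ Hk) | cle (B1 &+ A2 &+ Hk)].
Qed.

Lemma continuous_abs {N} (f : point R N -> C) : continuous f -> continuous (fun x => CRabs R (f x)).
Proof.
  intros H r eps Heps. destruct (H r eps Heps) as [d Hd K]. exists d; [exact Hd|].
  intros x y Hx Hy Hxy. exact (CRle_trans _ _ _ (CRabs_triang_inv2 _ _) (K x y Hx Hy Hxy)).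
Qed.

(** A point where the absolute values of a representation have a convergent series is in the domain
    of the integrable function, by [rep_value]. *)
Lemma full_meets_box {N} (A : subset R N) (c : point R N) s : full A -> 0 < s ->
  {x : point R N & A x & in_box c s x}.
Proof.
  intros [f [I [rep Htest rint Hrint rabs Hrabs [S HS] Hval HI]] Hf] Hs.
  destruct (convergence_point c s (fun n x => CRabs R (rep n x)) rabs S Hs) as [x Hx Hcv].
  - intro n. apply mean_bounded_integral; try assumption.
    + apply continuous_abs. apply (Htest n).
    + intro. apply CRabs_pos.
    + apply Hrabs.
  - exact HS.
  - exists x; [|exact Hx]. apply Hf. exact (projT1 (Hval x Hcv)).
Qed.

(** * Convex sets and orthants *)

Lemma convex_comb_gt (t a b d : C) : 0 < t -> 0 < 1 - t -> a < b -> a < d ->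
  a < t * b + (1 - t) * d.
Proof.
  intros H1 H2 Hb Hd.
  apply (CRmult_lt_compat_l t) in Hb; [|exact H1].
  apply (CRmult_lt_compat_l (1 - t)) in Hd; [|exact H2].
  apply CRlt_asym in Hd. clt (Hb <+ Hd).
Qed.

Lemma convex_comb_lt (t a b d : C) : 0 < t -> 0 < 1 - t -> b < a -> d < a ->
  t * b + (1 - t) * d < a.
Proof.
  intros H1 H2 Hb Hd.
  apply (CRmult_lt_compat_l t) in Hb; [|exact H1].
  apply (CRmult_lt_compat_l (1 - t)) in Hd; [|exact H2].
  apply CRlt_asym in Hd. clt (Hb <+ Hd).
Qed.

(** Coordinates are corrected one at a time, for all sign patterns at once. Two points on opposite
    sides of [x] in coordinate [i] have a convex combination that agrees with [x] there. It keeps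
    the earlier coordinates, and in the later ones it stays on the side given by [sigma]. *)
Lemma convex_orthants {N} (A : subset R N) (x : point R N) : convex A ->
  (forall sigma : Fin.t N -> bool, {p : point R N & A p &
     forall k, if sigma k then x k < p k else p k < x k}) ->
  A x.
Proof.
  intros HA H.
  assert (K : forall i, (i <= N)%nat -> forall sigma : Fin.t N -> bool,
    {p : point R N & A p &
     ((forall k, (fin_val k < i)%nat -> p k == x k) *
      (forall k, (i <= fin_val k)%nat -> if sigma k then x k < p k else p k < x k))%type}).
  { induction i as [|i IH]; intros Hi sigma.
    - destruct (H sigma) as [p Hp Hs]. exists p; [exact Hp|].
      split; [intros; lia | intros; apply Hs].
    - destruct (IH ltac:(lia) (fun j => if (fin_val j =? i)%nat then true else sigma j))
        as [p Hp [Ep Sp]].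
      destruct (IH ltac:(lia) (fun j => if (fin_val j =? i)%nat then false else sigma j))
        as [q Hq [Eq Sq]].
      set (k0 := Fin.of_nat_lt Hi).
      assert (E0 : fin_val k0 = i) by (unfold fin_val, k0; rewrite Fin.to_nat_of_nat; reflexivity).
      pose proof (Sp k0 ltac:(lia)) as P0. pose proof (Sq k0 ltac:(lia)) as Q0. cbv beta in P0, Q0.
      rewrite E0, Nat.eqb_refl in P0, Q0.
      assert (D0 : 0 < p k0 - q k0).
      { apply CRlt_minus. exact (CRlt_trans _ _ _ Q0 P0). }
      (* The weight for which the combination has coordinate [x k0] in direction [k0]. *)
      set (t := (x k0 - q k0) * CRinv R (p k0 - q k0) (inr D0)).
      pose proof (CRinv_0_lt_compat R _ (inr D0) D0) as I0.
      pose proof (CRinv_l R _ (inr D0)) as Il. fold (p k0 - q k0) in Il.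
      assert (T0 : 0 < t) by (apply CRmult_lt_0_compat; [apply CRlt_minus, Q0 | exact I0]).
      assert (T1 : 0 < 1 - t).
      { apply CRlt_le_trans with ((p k0 - x k0) * CRinv R (p k0 - q k0) (inr D0)).
        - apply CRmult_lt_0_compat; [apply CRlt_minus, P0 | exact I0].
        - apply CRle_eq. rewrite <- Il. unfold t. ring. }
      exists (fun k => t * p k + (1 - t) * q k).
      + apply HA; try assumption; [apply CRlt_asym, T0|].
        apply CRlt_asym in T1. cle T1.
      + split.
        * intros k Hk. destruct (Nat.eq_dec (fin_val k) i) as [E|E].
          -- assert (k = k0) by (apply Fin.to_nat_inj; fold (fin_val k) (fin_val k0); lia).
             subst k.
             transitivity (q k0 + (x k0 - q k0) * (CRinv R (p k0 - q k0) (inr D0) * (p k0 - q k0)));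
               [unfold t; ring|]. rewrite Il. ring.
          -- rewrite (Ep k), (Eq k) by lia. ring.
        * intros k Hk. specialize (Sp k ltac:(lia)). specialize (Sq k ltac:(lia)).
          cbv beta in Sp, Sq.
          destruct (Nat.eqb_spec (fin_val k) i); [lia|].
          destruct (sigma k); [apply convex_comb_gt | apply convex_comb_lt]; assumption. }
  destruct (K N (Nat.le_refl N) (fun _ => true)) as [p Hp [E _]].
  apply (mem_ext A p x); [|exact Hp]. intro k. apply E.
  unfold fin_val. destruct (Fin.to_nat k); assumption.
Qed.

(** * Approximate decisions on a grid *)

Lemma range_decide (P : Type) (Q : nat -> Type) n : (forall i, P + Q i) ->
  P + (forall i, (i <= n)%nat -> Q i).
Proof.
  intro H. induction n as [|n [IH|IH]].
  - destruct (H O) as [p|q]; [left; exact p | right]. intros i Hi.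
    replace i with O by lia. exact q.
  - left; exact IH.
  - destruct (H (S n)) as [p|q]; [left; exact p | right]. intros i Hi.
    destruct (Nat.eq_dec i (S n)) as [->|]; [exact q | apply IH; lia].
Qed.

Lemma grid_decide {N} T (P : Type) (Q : Vector.t nat N -> Type) : (forall w, P + Q w) ->
  P + (forall w, (forall k, (Vector.nth w k <= T)%nat) -> Q w).
Proof.
  induction N as [|N IH]; intro H.
  - destruct (H (Vector.nil nat)) as [p|q]; [left; exact p | right].
    intros w _. apply (Vector.case0 Q q).
  - destruct (range_decide P (fun i => forall w : Vector.t nat N,
      (forall k, (Vector.nth w k <= T)%nat) -> Q (Vector.cons nat i N w)) T) as [p|q].
    + intro i. apply IH. intro w. apply H.
    + left; exact p.
    + right. intro w. apply (Vector.caseS' w). intros i v Hv. apply q.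
      * exact (Hv Fin.F1).
      * intro k. exact (Hv (Fin.FS k)).
Qed.

Lemma vector_of_fun {N} (f : Fin.t N -> nat) :
  {w : Vector.t nat N & forall k, Vector.nth w k = f k}.
Proof.
  induction N as [|N IH].
  - exists (Vector.nil nat). intro k. apply (Fin.case0 (fun k => _ = f k) k).
  - destruct (IH (fun k => f (Fin.FS k))) as [w Hw].
    exists (Vector.cons nat (f Fin.F1) N w). intro k.
    apply (Fin.caseS' k); [reflexivity | exact Hw].
Qed.

(** An approximate integer part: the windows overlap, so that cotransitivity can choose one without
    an exact comparison with multiples of [d]. *)
Lemma locate (y d : C) n : 0 < d -> 0 < y -> y < INR n * d ->
  {t : nat & (t <= n)%nat & ((INR t - 1) * d < y < (INR t + 1) * d)}.
Proof.
  intros Hd Hy. induction n as [|n IH]; intro H.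
  - exfalso. apply (CRlt_asym _ _ Hy). unfold INR in H; simpl in H. clt H.
  - rewrite INR_S in H. destruct (CRltLinear R) as [_ split].
    destruct (split ((INR n - 1) * d) y (INR n * d)) as [L|L].
    + clt Hd.
    + exists n; [lia | split; assumption].
    + destruct (IH L) as [t Ht B]. exists t; [lia | exact B].
Qed.

Lemma rho_sym {N} (x y : point R N) : rho x y == rho y x.
Proof. apply CRsqrt_ext, fin_sum_ext. intro i. ring. Qed.

Lemma CRsqr_lt_reg (a b : C) : 0 <= a -> 0 < b -> a * a < b * b -> a < b.
Proof.
  intros Ha Hb H. apply CRmult_lt_reg_r with (b + a).
  - apply CRlt_le_trans with b; [exact Hb | cle Ha].
  - clt H.
Qed.

(** Squares avoid the root. Each coordinate difference is at most [a] and grows by at most [e],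
    whence the cross term [2 e a]. *)
Lemma sqdist_perturb {N} (x y z : point R N) a e : 0 <= e -> rho x y <= a ->
  (forall k, CRabs R (y k - z k) <= e) ->
  sqdist x z <= a * a + INR N * (CR_of_Q R 2 * e * a + e * e).
Proof.
  intros He Hr Hz.
  apply CRle_trans with
    (fin_sum (fun k => (x k - y k) * (x k - y k)) + INR N * (CR_of_Q R 2 * e * a + e * e)).
  - rewrite <- fin_sum_const.
    assert (Plus : forall n (f g : Fin.t n -> C),
      fin_sum f + fin_sum g == fin_sum (fun i => f i + g i)).
    { clear. unfold fin_sum. induction n as [|n IH]; intros f g; simpl; [ring|].
      rewrite <- IH. ring. }
    rewrite Plus. apply fin_sum_le. intro k.
    rewrite <- (CRabs_sqr (x k - z k)), <- (CRabs_sqr (x k - y k)).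
    assert (T : CRabs R (x k - z k) <= CRabs R (x k - y k) + e).
    { pose proof (CRabs_triang (x k - y k) (y k - z k)) as T.
      setoid_replace (x k - y k + (y k - z k)) with (x k - z k) in T by ring.
      cle (T &+ Hz k). }
    apply (CRle_trans _ _ _ (CRsqr_le_compat _ _ (CRabs_pos _) T)).
    pose proof (CRmult_le_compat_l e _ _ He (CRle_trans _ _ _ (coord_le_rho x y k) Hr)) as K.
    cle (2 &* K).
  - apply CRplus_le_compat_r. change (sqdist x y <= a * a). rewrite <- rho_sqr.
    apply CRsqr_le_compat; [apply rho_nonneg | exact Hr].
Qed.

(** * The distance to the complement: approximate comparison and bisection *)

Section Decision.
Context {N : nat}.
Variable (A : complemented_set R N).
Hypotheses (Hfull : full (dom (chi A))) (Hconv : convex (in1 A)).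

Lemma in0_complement x : in0 A x -> complement (in1 A) x.
Proof.
  intros H y Hy. unfold pt_apart. rewrite rho_sym. exact (in1_in0_apart A y x Hy H).
Qed.

Section Grid.
Variables (x : point R N) (d : C) (K : nat).
Hypothesis (Hd : 0 < d).

(** The cell with all indices [K + 2] has lower corner [x]. The offset 2 leaves two layers of cells
    around the cube of radius [K * d], as room for cells on either side of its points. *)
Definition grid_corner (w : Vector.t nat N) : point R N :=
  fun k => x k + (INR (Vector.nth w k) - INR K - CR_of_Q R 2) * d.

(** In each coordinate some cell lies strictly above [y] and some strictly below, with lower corners
    within [3 * d]. Choosing by [sigma] gives a cell in every open orthant at [y]. *)
Lemma mem_of_near_cells (y : point R N) :
  (forall k, CRabs R (x k - y k) < INR K * d) ->
  (forall w : Vector.t nat N, (forall k, (Vector.nth w k <= K + K + 3)%nat) ->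
     (forall k, CRabs R (y k - grid_corner w k) <= CR_of_Q R 3 * d) ->
     {p : point R N & in1 A p & in_box (grid_corner w) d p}) ->
  in1 A y.
Proof.
  intros Hy Hcell. apply convex_orthants; [exact Hconv|]. intro sigma.
  assert (Loc : forall k, {t : nat & (t <= K + K)%nat &
     ((INR t - 1) * d < y k - x k + INR K * d < (INR t + 1) * d)}).
  { intro k. destruct (CRabs_lt _ _ (Hy k)) as [L1 L2].
    apply locate; [exact Hd | clt L1 | rewrite INR_plus; clt L2]. }
  (* [y k] lies strictly between [x k + (t - 1 - K) * d], where cell [t] ends, and
     [x k + (t + 1 - K) * d], where cell [t + 3] begins. *)
  destruct (vector_of_fun (fun k => if sigma k then (projT1 (sigT_of_sigT2 (Loc k)) + 3)%nat
                                    else projT1 (sigT_of_sigT2 (Loc k)))) as [w Hw].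
  pose proof (CRlt_asym _ _ Hd) as d0.
  assert (E3 : @INR R 3 == CR_of_Q R 3) by (apply CR_of_Q_morph; reflexivity).
  destruct (Hcell w) as [p Hp Bp].
  - intro k. rewrite Hw. destruct (Loc k) as [t Ht Bt]; simpl. destruct (sigma k); lia.
  - intro k. unfold grid_corner. rewrite Hw. destruct (Loc k) as [t Ht [B1 B2]]; simpl.
    apply CRlt_asym in B1. apply CRlt_asym in B2.
    destruct (sigma k); [rewrite INR_plus, E3|]; apply CRabs_le; split.
    + cle (B1 &+ d0).
    + cle (B2 &+ 3 &* d0).
    + cle (B1 &+ 4 &* d0).
    + cle B2.
  - exists p; [exact Hp|]. intro k. destruct (Bp k) as [P1 P2].
    unfold grid_corner in P1, P2. rewrite Hw in P1, P2.
    destruct (Loc k) as [t Ht [B1 B2]]; simpl in P1, P2.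
    destruct (sigma k).
    + rewrite INR_plus, E3 in P1. clt (B2 <+ P1).
    + clt (B1 <+ P2).
Qed.
End Grid.

(** The gap is cut into two pieces [h]: the first leaves room to decide whether a cell is near, the
    second covers the way from its corner to the point found in it. All comparisons are between
    squared distances. *)
Lemma distance_decide (x : point R N) (a b : C) : 0 <= a -> a < b ->
  {y : point R N & complement (in1 A) y & rho x y < b} +
  (forall y, complement (in1 A) y -> a <= rho x y).
Proof.
  intros Ha Hab.
  set (h := half * (b - a)).
  assert (Hh : 0 < h).
  { unfold h. clt ((1#2) <* Hab). }
  assert (Eb : b == a + h + h) by (unfold h; ring).
  (* The 18 reduces the error [6 m h + 9 h^2] of coordinate shifts up to [3 d] at radius [m] to
     [m h / 3 + h^2 / 2]. *)
  set (kappa := CR_of_Q R (1 # 18 * Pos.of_succ_nat N)).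
  assert (K0 : 0 < kappa) by (apply CR_of_Q_lt; reflexivity).
  assert (K1 : kappa <= 1).
  { apply CR_of_Q_le. unfold Qle, Qnum, Qden. lia. }
  assert (KN : INR N * kappa <= CR_of_Q R (1 # 18)).
  { unfold INR, kappa. rewrite <- CR_of_Q_mult. apply CR_of_Q_le.
    unfold Qle, Qmult, Qnum, Qden. lia. }
  assert (KN0 : 0 <= INR N * kappa).
  { apply CRmult_le_0_compat; [apply INR_nonneg | apply CRlt_asym, K0]. }
  set (d := kappa * h).
  assert (Hd : 0 < d) by (apply CRmult_lt_0_compat; assumption).
  pose proof (CRlt_asym _ _ Hd) as d0. pose proof (CRlt_asym _ _ Hh) as h0.
  assert (HH : 0 < h * h) by (apply CRmult_lt_0_compat; assumption).
  assert (Hah : 0 <= a * h) by (apply CRmult_le_0_compat; assumption).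
  assert (Error : forall e m, 0 <= e -> e <= CR_of_Q R 3 -> 0 <= m ->
    INR N * (CR_of_Q R 2 * (e * d) * m + e * d * (e * d))
    <= CR_of_Q R (1 # 3) * (m * h) + CR_of_Q R (1 # 2) * (h * h)).
  { intros e m He0 He Hm.
    apply CRle_trans with (INR N * kappa * (CR_of_Q R 6 * (m * h) + CR_of_Q R 9 * (h * h))).
    - apply CRle_trans with (INR N * kappa * (CR_of_Q R 2 * e * (m * h) + e * e * kappa * (h * h)));
        [unfold d; apply CRle_eq; ring|].
      apply CRmult_le_compat_l; [exact KN0|]. apply CRplus_le_compat.
      + apply CRmult_le_compat_r; [apply CRmult_le_0_compat; assumption|]. cle (2 &* He).
      + apply CRmult_le_compat_r; [apply CRlt_asym, HH|].
        apply CRle_trans with (e * e * 1).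
        * apply CRmult_le_compat_l; [apply CRsqr_nonneg | exact K1].
        * pose proof (CRsqr_le_compat _ _ He0 He) as Q. cle Q.
    - apply (CRmult_le_compat_r (CR_of_Q R 6 * (m * h) + CR_of_Q R 9 * (h * h))) in KN.
      + refine (CRle_trans _ _ _ KN _). apply CRle_eq. ring.
      + pose proof (CRmult_le_0_compat _ _ Hm h0) as Q. apply CRlt_asym in HH.
        cle (6 &* Q &+ 9 &* HH). }
  destruct (archimedean_mult a d Hd) as [K HK].
  (* Bounds the squared distance from [x] to any corner within [3 * d], in each coordinate, of a
     point at distance at most [a]. *)
  set (lo := a * a + INR N * (CR_of_Q R 2 * (CR_of_Q R 3 * d) * a
               + CR_of_Q R 3 * d * (CR_of_Q R 3 * d))).
  assert (Hlo : lo < (a + h) * (a + h)).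
  { assert (Q : lo <= a * a + (CR_of_Q R (1 # 3) * (a * h) + CR_of_Q R (1 # 2) * (h * h))).
    { apply CRplus_le_compat_l, Error; try assumption;
        [apply CR_of_Q_le; discriminate | apply CRle_refl]. }
    clt ((1#2) <* HH <+ (5#3) &* Hah <+ Q). }
  destruct (@grid_decide N (K + K + 3) {y : point R N & complement (in1 A) y & rho x y < b}
    (fun w => ((lo < sqdist x (grid_corner x d K w)) +
       {p : point R N & in1 A p & in_box (grid_corner x d K w) d p})%type)) as [P|Q].
  - intro w. destruct (CRltLinear R) as [_ split].
    (* A cell is either too far to matter or near enough for its points to be at distance less than
       [b]. *)
    destruct (split _ (sqdist x (grid_corner x d K w)) _ Hlo) as [L|L];
      [right; left; exact L|].
    destruct (full_meets_box (dom (chi A)) (grid_corner x d K w) d Hfull Hd) as [p [Hp|Hp] Bp].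
    + right; right. exists p; assumption.
    + left. exists p; [apply in0_complement, Hp|].
      assert (ah0 : 0 <= a + h) by cle (Ha &+ h0).
      apply CRsqr_lt_reg; [apply rho_nonneg | exact (CRle_lt_trans _ _ _ Ha Hab)|].
      rewrite rho_sqr.
      apply CRle_lt_trans with ((a + h) * (a + h)
        + INR N * (CR_of_Q R 2 * (1 * d) * (a + h) + 1 * d * (1 * d))).
      * apply (sqdist_perturb x (grid_corner x d K w) p (a + h) (1 * d)).
        -- cle d0.
        -- apply CRsqr_le_reg; [exact ah0|]. rewrite rho_sqr. apply CRlt_asym, L.
        -- intro k. destruct (Bp k) as [B1 B2]. apply CRabs_le. split; [cle B2 | cle (B1 &+ d0)].
      * pose proof (Error 1 (a + h) (CR_of_Q_le 0 1 ltac:(discriminate))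
          (CR_of_Q_le 1 3 ltac:(discriminate)) ah0) as E.
        rewrite Eb.
        clt ((1#6) <* HH <+ (5#3) &* Hah <+ E <+ 2 &* CRlt_asym _ _ HH).
  - left; exact P.
  - right. intros y Hy L.
    (* A point of the complement nearer than [a] would belong to [in1 A] and so be apart from
       itself. *)
    assert (Iny : in1 A y).
    { apply (mem_of_near_cells x d K Hd).
      - intro k. apply CRle_lt_trans with (rho x y); [apply coord_le_rho|].
        exact (CRlt_le_trans _ _ _ L HK).
      - intros w Hw Hn. destruct (Q w Hw) as [F|F]; [|exact F]. exfalso.
        apply (sqdist_perturb x y (grid_corner x d K w) a (CR_of_Q R 3 * d)); try assumption.
        + cle (3 &* d0).
        + apply CRlt_asym, L. }
    exact (pt_apart_neq y y (Hy y Iny) (fun k => CReq_refl (y k))).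
Qed.

(** Two decisions at overlapping quarter marks replace a comparison with the midpoint. The new lower
    bound is [a], [a + d / 4] or [a + d / 2], and in each case a point is known within [d / 2] above
    it. *)
Lemma distance_bisect (x : point R N) (a d : C) : 0 <= a -> 0 < d ->
  (forall y, complement (in1 A) y -> a <= rho x y) ->
  {y : point R N & complement (in1 A) y & rho x y < a + d} ->
  {a' : C & (a <= a' <= a + half * d) &
    prod (forall y, complement (in1 A) y -> a' <= rho x y)
      {y : point R N & complement (in1 A) y & rho x y < a' + half * d}}.
Proof.
  intros Ha Hd Hlow Hup. pose proof (CRlt_asym _ _ Hd) as d0.
  destruct (distance_decide x (a + CR_of_Q R (1 # 4) * d) (a + half * d)) as [U|L].
  - cle (Ha &+ (1#4) &* d0).
  - clt ((1#4) <* Hd).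
  - exists a; [|split; assumption]. split; [apply CRle_refl | cle ((1#2) &* d0)].
  - destruct (distance_decide x (a + half * d) (a + CR_of_Q R (3 # 4) * d)) as [[y Hy Uy]|L'].
    + cle (Ha &+ (1#2) &* d0).
    + clt ((1#4) <* Hd).
    + exists (a + CR_of_Q R (1 # 4) * d).
      * split; cle ((1#4) &* d0).
      * split; [exact L|]. exists y; [exact Hy|]. clt Uy.
    + exists (a + half * d).
      * split; [cle ((1#2) &* d0) | apply CRle_refl].
      * split; [exact L'|]. destruct Hup as [y Hy Uy]. exists y; [exact Hy|]. clt Uy.
Qed.

Lemma distance_exists (x z : point R N) : complement (in1 A) z ->
  {m : C & is_distance x (complement (in1 A)) m}.
Proof.
  (* The summand 1 makes [z] a strict witness for the initial bounds 0 and [s]. *)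
  intro Hz. set (s := rho x z + 1).
  assert (Hs : 0 < s).
  { apply CRlt_le_trans with (1 : C); [apply CRzero_lt_one|].
    pose proof (rho_nonneg x z) as Q. unfold s. cle Q. }
  assert (Hpw : forall l, 0 < pw l * s)
    by (intro; apply CRmult_lt_0_compat; [apply pw_pos | exact Hs]).
  set (St := fun l => {a : C & 0 <= a &
     prod (forall y, complement (in1 A) y -> a <= rho x y)
       {y : point R N & complement (in1 A) y & rho x y < a + pw l * s}}).
  assert (St0 : St O).
  { exists 0; [apply CRle_refl|]. split; [intros; apply rho_nonneg|]. exists z; [exact Hz|].
    simpl. unfold s. pose proof (@CRzero_lt_one R) as Q. clt Q. }
  assert (Next : forall l (p : St l), {q : St (S l) &
     projT1 (sigT_of_sigT2 p) <= projT1 (sigT_of_sigT2 q)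
       <= projT1 (sigT_of_sigT2 p) + pw (S l) * s}).
  { intros l [a Ha [Hl Hu]].
    destruct (distance_bisect x a (pw l * s) Ha (Hpw l) Hl Hu) as [a' [B1 B2] [Hl' [y Hy Uy]]].
    unshelve eexists.
    - exists a'; [exact (CRle_trans _ _ _ Ha B1)|]. split; [exact Hl'|].
      exists y; [exact Hy|]. rewrite pw_S. clt Uy.
    - simpl. split; [exact B1|]. cle B2. }
  set (path := nat_rect St St0 (fun l p => projT1 (Next l p))).
  destruct (nested_limit (fun l => projT1 (sigT_of_sigT2 (path l))) s (CRlt_asym _ _ Hs)) as [m Hm].
  { intro l. exact (projT2 (Next l (path l))). }
  exists m. split.
  - intros y Hy L.
    (* At a stage of width at most half the gap, the lower bound [a <= rho x y] forces [m] below the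
       middle of the gap. *)
    assert (Q : 0 < half * (m - rho x y)) by (clt ((1#2) <* L)).
    destruct (pw_small s _ Q) as [l Hl]. specialize (Hl l (Nat.le_refl l)).
    destruct (Hm l) as [_ M]. destruct (path l) as [a Ha [Hlow Hup]]; simpl in M.
    specialize (Hlow y Hy).
    apply (CRle_refl (0 : C)). apply (CRlt_le_trans _ _ _ Q).
    cle (M &+ Hlow &+ Hl).
  - intros eps Heps.
    destruct (pw_small s eps Heps) as [l Hl]. specialize (Hl l (Nat.le_refl l)).
    destruct (Hm l) as [M _]. destruct (path l) as [a Ha [Hlow [y Hy Uy]]]; simpl in M.
    exists y; [exact Hy|]. clt (Uy <+ M <+ Hl).
Qed.
End Decision.
End Located.

Theorem theorem2 (R : ConstructiveReals) (N : nat) (hN : (0 < N)%nat)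
  (A : complemented_set R N) :
  measurable_set A -> convex (in1 A) -> inhabited_set (complement (in1 A)) ->
  located (complement (in1 A)).
Proof.
  intros [Hfull _] Hconv [z Hz]. split.
  - exists z. exact Hz.
  - intro x. exact (distance_exists A Hfull Hconv x z Hz).
Qed.
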